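(* Let $d\ge 3$ and let $(X(t))_{t\ge t_0}$ be the vertex-reinforced random walk on the complete-like graph $\mathcal G_d$ (with arbitrary leaf numbers $r_1,\dots,r_d\ge 0$ and arbitrary positive integer initial weights). Then $\mathbb P(\pi_\infty=\pi_{\mathsf{unif}})=1$.
   Context: Let $d\ge 2$ and $r_1,\dots,r_d\ge 0$ be integers. The complete-like graph $\mathcal G_d$ has vertex set $V_d=\{1,\dots,d\}\cup\{\ell^i_r: 1\le i\le d,\ 1\le r\le r_i\}$. The vertices $1,\dots,d$ are called interior, and every pair of distinct interior vertices is joined by an edge; for each $i$, the vertices $\ell^i_1,\dots,\ell^i_{r_i}$ are the leaves attached to $i$, each joined by an edge to $i$ only; there are no other edges. Write $v\sim w$ if $v,w$ are joined by an edge. Vertex-reinforced random walk (VRRW) on $\mathcal G_d$: fix positive integers $z(0,v)$, $v\in V_d$, put $t_0=\sum_{v\in V_d}z(0,v)$, let $X(t_0)\in V_d$ be a given starting vertex, and for $t\ge t_0$ let $Z(t,v)=z(0,v)+\#\{s\in\{t_0+1,\dots,t\}: X(s)=v\}$ (so $\sum_v Z(t,v)=t$). Let $\mathcal F_t=\sigma(X(s),t_0\le s\le t)$. The transitions are $\mathbb P(X(t+1)=w\mid\mathcal F_t)=Z(t,w)/\sum_{y\sim X(t)}Z(t,y)$ for $w\sim X(t)$. Let $\pi(t)=(Z(t,v)/t)_{v\in V_d}\in\mathbb R^{|V_d|}$ be the empirical occupation measure, let $\pi_\infty=\lim_{t\to\infty}\pi(t)$ on the event that this limit exists and $\pi_\infty=0$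 (zero vector) otherwise, and let $\pi_{\mathsf{unif}}\in\mathbb R^{|V_d|}$ be the vector with coordinate $1/d$ at each interior vertex and $0$ at each leaf. *)

(* Defs.v *)
From Stdlib Require Import Reals List Arith.
Import ListNotations.
Open Scope R_scope.

(* Vertices of G_d, 0-indexed: interior vertex [Int i] (0 <= i < d) stands for
   vertex i+1; [Leaf i k] (0 <= k < r i) stands for the leaf l^{i+1}_{k+1}. *)
Inductive vtx : Type := Int (i : nat) | Leaf (i k : nat).

Definition vtx_eq_dec (x y : vtx) : {x = y} + {x <> y}.
Proof. decide equality; apply Nat.eq_dec. Defined.

Definition validb (d : nat) (r : nat -> nat) (v : vtx) : bool :=
  match v with
  | Int i => Nat.ltb i d
  | Leaf i k => Nat.ltb i d && Nat.ltb k (r i)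
  end.

Definition valid (d : nat) (r : nat -> nat) (v : vtx) : Prop := validb d r v = true.

Definition adjb (d : nat) (r : nat -> nat) (x y : vtx) : bool :=
  validb d r x && validb d r y &&
  match x, y with
  | Int i, Int j => negb (Nat.eqb i j)
  | Int i, Leaf j _ => Nat.eqb i j
  | Leaf i _, Int j => Nat.eqb i j
  | Leaf _ _, Leaf _ _ => false
  end.

Definition verts (d : nat) (r : nat -> nat) : list vtx :=
  map Int (seq 0 d) ++ flat_map (fun i => map (Leaf i) (seq 0 (r i))) (seq 0 d).

Definition sumR (l : list vtx) (f : vtx -> R) : R :=
  fold_right (fun v acc => f v + acc) 0 l.

Definition t0 (d : nat) (r : nat -> nat) (z0 : vtx -> nat) : nat :=
  fold_right (fun v acc => (z0 v + acc)%nat) 0%nat (verts d r).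

(* A path is omega : nat -> vtx with omega n = X(t0 + n). *)
Definition path := nat -> vtx.

Fixpoint visits (omega : path) (v : vtx) (n : nat) : nat :=
  match n with
  | O => O
  | S m => (visits omega v m + if vtx_eq_dec (omega (S m)) v then 1 else 0)%nat
  end.

Definition Zw (z0 : vtx -> nat) (omega : path) (n : nat) (v : vtx) : R :=
  INR (z0 v + visits omega v n).

(* P(X(t0+n+1) = w | F_{t0+n}) evaluated on the path omega. *)
Definition trans (d : nat) (r : nat -> nat) (z0 : vtx -> nat)
  (omega : path) (n : nat) (w : vtx) : R :=
  let x := omega n in
  if adjb d r x w then
    Zw z0 omega n w /
      sumR (filter (adjb d r x) (verts d r)) (Zw z0 omega n)
  else 0.

Fixpoint cylP (d : nat) (r : nat -> nat) (z0 : vtx -> nat) (x0 : vtx)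
  (omega : path) (n : nat) : R :=
  match n with
  | O => if vtx_eq_dec (omega O) x0 then 1 else 0
  | S m => cylP d r z0 x0 omega m * trans d r z0 omega m (omega (S m))
  end.

Definition in_cyl (c : path) (n : nat) (omega : path) : Prop :=
  forall m, (m <= n)%nat -> omega m = c m.

Definition vrrw_null (d : nat) (r : nat -> nat) (z0 : vtx -> nat) (x0 : vtx)
  (A : path -> Prop) : Prop :=
  forall eps : R, 0 < eps ->
    exists (c : nat -> path) (len : nat -> nat),
      (forall omega, A omega -> exists k, in_cyl (c k) (len k) omega) /\
      (forall N, sum_f_R0 (fun k => cylP d r z0 x0 (c k) (len k)) N <= eps).

Definition vrrw_as (d : nat) (r : nat -> nat) (z0 : vtx -> nat) (x0 : vtx)
  (E : path -> Prop) : Prop :=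
  vrrw_null d r z0 x0 (fun omega => ~ E omega).

Definition pi_emp (d : nat) (r : nat -> nat) (z0 : vtx -> nat)
  (omega : path) (n : nat) (v : vtx) : R :=
  Zw z0 omega n v / INR (t0 d r z0 + n).

Definition pi_unif (d : nat) (v : vtx) : R :=
  match v with
  | Int _ => / INR d
  | Leaf _ _ => 0
  end.

(* The event {pi_infty = pi_unif}: the limit of pi(t) exists and equals
   pi_unif (coordinatewise over V_d).  If the limit does not exist then
   pi_infty = 0 <> pi_unif, so this is exactly that event. *)
Definition pi_inf_is_unif (d : nat) (r : nat -> nat) (z0 : vtx -> nat)
  (omega : path) : Prop :=
  forall v, valid d r v -> Un_cv (fun n => pi_emp d r z0 omega n v) (pi_unif d v).

(* Main.v *)
(* Write T for the time, Z_j for the weight of the interior vertex j, L_j for the weight of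
   its leaves.  The empirical entropy sum_j ln (Z_j / T) is a Lyapunov function.  Let
   S = sum_j Z_j and L = sum_j L_j.  Up to a corrector of order 1 / T, solving the Poisson
   equation of the walk with frozen weights, and up to pole terms b / Z_j that absorb the
   second order errors, its drift from j is F / (T S N_j) with N_j = S - Z_j + L_j and
     F = d sum (Z_j - L_j)^2 - (S - L)^2 + d (L^2 - sum L_j^2) + (d - 2) L (S - L).
   For d >= 3 this is nonnegative up to O(T), because L <= S + O(1).  So the defect of the
   entropy, and this defect plus the accumulated drift, are nonnegative supermartingales
   and converge almost surely.  The entropy being bounded below, every Z_j stays
   proportional to T; the drift being summable against a harmonic series, F / T^2 comes
   close to 0 infinitely often, which for such weights forces Z_j / T close to 1 / d.
   Hence the entropy converges to its maximum, and strict concavity gives the claim.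
   Null sets are handled by Ville's inequality: the words at which a nonnegative
   supermartingale first exceeds 1 are prefix free and form the covering. *)
Require Import Defs.
From Stdlib Require Import Reals List Arith Lia Lra Classical ClassicalEpsilon Cantor FinFun FunctionalExtensionality.
Import ListNotations.
Open Scope R_scope.

(** The bound L <= S + O(1) holds because every visit to a leaf is paired with a visit to its
    interior neighbour. The term (d - 2) L (S - L) is what expels the leaves. For d = 2 it
    disappears, and F = (Z_0 - L_0 - Z_1 + L_1)^2 + 4 L_0 L_1 also vanishes at configurations with
    L_0 = 0 < L_1. For d >= 3 the other way to cancel it, S close to L, is excluded by the products
    L_i L_j. Smallness of F along some sequence of times is enough: it identifies a limit of the
    entropy that is already known to exist. Null sets are defined by cylinder coverings and no
    measure is constructed, so almost sure statements are proved by betting: a capital started at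
    eps must reach 1 on the exceptional set. *)

(** * Finite sums over lists *)

Definition sumL {A : Type} (l : list A) (f : A -> R) : R :=
  fold_right (fun v acc => f v + acc) 0 l.

Arguments sumL : simpl never.

Lemma sumL_app {A} (l1 l2 : list A) f : sumL (l1 ++ l2) f = sumL l1 f + sumL l2 f.
Proof. induction l1; unfold sumL in *; simpl; lra. Qed.

Lemma sumL_cons {A} (a : A) l f : sumL (a :: l) f = f a + sumL l f.
Proof. reflexivity. Qed.

Lemma sumL_map {A B} (g : A -> B) l f : sumL (map g l) f = sumL l (fun x => f (g x)).
Proof. induction l; simpl; rewrite ?sumL_cons; [reflexivity|]. now rewrite IHl. Qed.

Lemma sumL_flat_map {A B} (g : A -> list B) l f :
  sumL (flat_map g l) f = sumL l (fun x => sumL (g x) f).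
Proof. induction l; simpl; rewrite ?sumL_cons, ?sumL_app; [reflexivity|]. now rewrite IHl. Qed.

Lemma sumL_ext {A} (l : list A) f g : (forall x, In x l -> f x = g x) -> sumL l f = sumL l g.
Proof.
  induction l; intros H; [reflexivity|]. rewrite !sumL_cons, H by (left; auto).
  rewrite IHl; auto. intros; apply H; right; auto.
Qed.

Lemma sumL_le {A} (l : list A) f g : (forall x, In x l -> f x <= g x) -> sumL l f <= sumL l g.
Proof.
  induction l; intros H; [apply Rle_refl|]. rewrite !sumL_cons.
  apply Rplus_le_compat; [apply H; left; auto|]. apply IHl; intros; apply H; right; auto.
Qed.

Lemma sumL_plus {A} (l : list A) f g : sumL l (fun x => f x + g x) = sumL l f + sumL l g.
Proof. induction l; rewrite ?sumL_cons; [unfold sumL; simpl; lra|]. rewrite IHl; lra. Qed.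

Lemma sumL_scal {A} (l : list A) c f : sumL l (fun x => c * f x) = c * sumL l f.
Proof. induction l; rewrite ?sumL_cons; [unfold sumL; simpl; lra|]. rewrite IHl; lra. Qed.

Lemma sumL_const {A} (l : list A) c : sumL l (fun _ => c) = INR (length l) * c.
Proof.
  induction l; [unfold sumL; simpl; lra|]. rewrite sumL_cons, IHl.
  change (length (a :: l)) with (S (length l)). rewrite S_INR; lra.
Qed.

Lemma sumL_nonneg {A} (l : list A) f : (forall x, In x l -> 0 <= f x) -> 0 <= sumL l f.
Proof.
  intros H. apply Rle_trans with (sumL l (fun _ => 0)); [rewrite sumL_const; lra|].
  now apply sumL_le.
Qed.

Lemma sumL_filter {A} (l : list A) p f :
  sumL (filter p l) f = sumL l (fun x => if p x then f x else 0).
Proof.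
  induction l; simpl; [reflexivity|]. rewrite sumL_cons.
  destruct (p a); rewrite ?sumL_cons, IHl; lra.
Qed.

Lemma sumL_swap {A B} (l : list A) (m : list B) f :
  sumL l (fun x => sumL m (fun y => f x y)) = sumL m (fun y => sumL l (fun x => f x y)).
Proof.
  induction l.
  - change (0 = sumL m (fun _ => 0)). rewrite sumL_const; lra.
  - rewrite sumL_cons, IHl, <- sumL_plus. reflexivity.
Qed.

Lemma sumL_indicator {A} (dec : forall x y : A, {x = y} + {x <> y}) l (a : A) f :
  NoDup l -> sumL l (fun x => if dec x a then f x else 0) = if in_dec dec a l then f a else 0.
Proof.
  induction 1 as [|x l Hx Hl IH]; [reflexivity|]. rewrite sumL_cons, IH.
  destruct (dec x a) as [->|Hne].
  - destruct (in_dec dec a l); [contradiction|].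
    destruct (in_dec dec a (a :: l)) as [|n']; [lra|destruct n'; left; auto].
  - destruct (in_dec dec a l) as [i|i]; destruct (in_dec dec a (x :: l)) as [j|j]; try lra.
    + destruct j; right; auto.
    + destruct j; congruence.
Qed.

Lemma sumL_incl {A} (l l' : list A) f :
  NoDup l -> incl l l' -> (forall x, 0 <= f x) -> sumL l f <= sumL l' f.
Proof.
  intros Hnd; revert l'. induction Hnd as [|x l Hx Hnd IH]; intros l' Hi Hf.
  - apply sumL_nonneg; auto.
  - destruct (in_split x l') as (l1 & l2 & ->); [apply Hi; left; auto|].
    rewrite sumL_app, !sumL_cons.
    enough (sumL l f <= sumL (l1 ++ l2) f) by (rewrite sumL_app in H; lra).
    apply IH; auto. intros y Hy.
    assert (H : In y (l1 ++ x :: l2)) by (apply Hi; right; auto).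
    apply in_app_or in H. apply in_or_app. destruct H as [|[|]]; auto. subst; contradiction.
Qed.

Lemma sumL_seq_sum_f_R0 f N : sumL (seq 0 (S N)) f = sum_f_R0 f N.
Proof.
  induction N; [unfold sumL; simpl; lra|].
  rewrite seq_S, sumL_app, IHN. simpl. unfold sumL; simpl; lra.
Qed.

(** * Null sets and supermartingales *)

Definition upd (omega : path) (n : nat) (w : vtx) : path :=
  fun m => if Nat.eqb m n then w else omega m.

Definition agree (n : nat) (omega omega' : path) : Prop :=
  forall m, (m <= n)%nat -> omega m = omega' m.

Definition adapted {A} (K : path -> nat -> A) : Prop :=
  forall omega omega' n, agree n omega omega' -> K omega n = K omega' n.

Lemma upd_eq omega n w : upd omega n w n = w.
Proof. unfold upd; now rewrite Nat.eqb_refl. Qed.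

Lemma agree_upd omega n m w : (m < n)%nat -> agree m (upd omega n w) omega.
Proof. intros H k Hk. unfold upd. destruct (Nat.eqb_spec k n); [lia|auto]. Qed.

Lemma visits_adapted v : adapted (fun omega n => visits omega v n).
Proof.
  intros o o' n; induction n; intros H; [reflexivity|]. simpl.
  rewrite IHn by (intros m Hm; apply H; lia). now rewrite (H (S n)) by lia.
Qed.

Section Walk.

Context (d : nat) (r : nat -> nat) (z0 : vtx -> nat) (x0 : vtx).

Let tr := trans d r z0.
Let cyl := cylP d r z0 x0.
Let V := verts d r.

Lemma in_verts v : In v V <-> validb d r v = true.
Proof.
  unfold V, verts. rewrite in_app_iff, in_map_iff, in_flat_map. destruct v as [i|i k]; simpl.
  - rewrite Nat.ltb_lt. split.
    + intros [(j & [= ->] & H)|(j & _ & H)]; [apply in_seq in H; lia|].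
      apply in_map_iff in H. destruct H as (? & [=] & _).
    + intros H; left; exists i; split; auto. apply in_seq; lia.
  - rewrite Bool.andb_true_iff, !Nat.ltb_lt. split.
    + intros [(j & [=] & H)|(j & Hj & H)]. apply in_map_iff in H.
      destruct H as (? & [= -> ->] & H). apply in_seq in H, Hj; lia.
    + intros [H1 H2]; right; exists i; split; [apply in_seq; lia|].
      apply in_map, in_seq; lia.
Qed.

Lemma nodup_verts : NoDup V.
Proof.
  unfold V, verts. apply NoDup_app.
  - apply FinFun.Injective_map_NoDup; [congruence|apply seq_NoDup].
  - generalize (seq_NoDup d 0). generalize (seq 0 d). induction 1 as [|x l Hx Hl IH]; simpl; [constructor|].
    apply NoDup_app; auto.
    + apply FinFun.Injective_map_NoDup; [congruence|apply seq_NoDup].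
    + intros a Ha Hb. apply in_map_iff in Ha. destruct Ha as (k & <- & _).
      apply in_flat_map in Hb. destruct Hb as (y & Hy & Hb). apply in_map_iff in Hb.
      destruct Hb as (? & [= -> _] & _). contradiction.
  - intros a Ha Hb. apply in_map_iff in Ha. destruct Ha as (k & <- & _).
    apply in_flat_map in Hb. destruct Hb as (y & Hy & Hb). apply in_map_iff in Hb.
    destruct Hb as (? & [=] & _).
Qed.

Lemma Zw_adapted v : adapted (fun omega n => Zw z0 omega n v).
Proof. intros o o' n H. unfold Zw. now rewrite (visits_adapted v o o' n H). Qed.

Lemma trans_adapted w : adapted (fun omega n => tr omega n w).
Proof.
  intros o o' n H. unfold tr, trans. rewrite (H n) by lia.
  rewrite (Zw_adapted w o o' n H).
  replace (Zw z0 o n) with (Zw z0 o' n); [reflexivity|].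
  apply functional_extensionality; intros v. symmetry; apply (Zw_adapted v o o' n H).
Qed.

Lemma cylP_adapted : adapted cyl.
Proof.
  intros o o' n; induction n; intros H; unfold cyl in *; simpl.
  - now rewrite (H 0%nat) by lia.
  - rewrite IHn by (intros m Hm; apply H; lia). rewrite (H (S n)) by lia.
    f_equal. apply trans_adapted. intros m Hm; apply H; lia.
Qed.

Lemma trans_nonneg omega n w : 0 <= tr omega n w.
Proof.
  unfold tr, trans. destruct adjb; [|lra].
  assert (H : 0 <= sumR (filter (adjb d r (omega n)) (verts d r)) (Zw z0 omega n)).
  { apply (@sumL_nonneg vtx). intros; apply pos_INR. }
  apply Rmult_le_pos; [apply pos_INR|].
  destruct H as [H|H]; [left; now apply Rinv_0_lt_compat|]. rewrite <- H, Rinv_0; lra.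
Qed.

Lemma trans_outside omega n w : ~ In w V -> tr omega n w = 0.
Proof.
  intros H. unfold tr, trans, adjb. rewrite in_verts in H.
  destruct (validb d r w); [congruence|]. now rewrite Bool.andb_false_r.
Qed.

Lemma cylP_nonneg omega n : 0 <= cyl omega n.
Proof.
  induction n; unfold cyl in *; simpl; [destruct vtx_eq_dec; lra|].
  apply Rmult_le_pos; auto. apply trans_nonneg.
Qed.

Lemma cylP_0 omega n : 0 < cyl omega n -> omega 0%nat = x0.
Proof.
  induction n; unfold cyl in *; simpl; [destruct vtx_eq_dec; auto; lra|].
  intros H; apply IHn. destruct (cylP_nonneg omega n) as [|E]; auto. unfold cyl in E; rewrite <- E in H; lra.
Qed.

Lemma cylP_S_pos omega n :
  0 < cyl omega (S n) -> 0 < cyl omega n /\ 0 < tr omega n (omega (S n)).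
Proof.
  intros H. change (0 < cyl omega n * tr omega n (omega (S n))) in H.
  destruct (cylP_nonneg omega n) as [|E]; [|rewrite <- E in H; lra].
  destruct (trans_nonneg omega n (omega (S n))) as [|E]; [tauto|rewrite <- E in H; lra].
Qed.

Lemma cylP_upd omega n w : cyl (upd omega (S n) w) (S n) = cyl omega n * tr omega n w.
Proof.
  change (cyl (upd omega (S n) w) n * tr (upd omega (S n) w) n (upd omega (S n) w (S n))
          = cyl omega n * tr omega n w).
  rewrite upd_eq. f_equal.
  - apply cylP_adapted, agree_upd; lia.
  - apply trans_adapted, agree_upd; lia.
Qed.

(** Required only on words of positive probability, because the bounds on the leaf weights are
    available only there. The sum over [V] is the conditional expectation; adaptedness makes the
    entries of [upd omega (S n) w] beyond [S n] immaterial. *)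
Record supermartingale (K : path -> nat -> R) : Prop := {
  sm_adapted : adapted K;
  sm_nonneg : forall omega n, 0 < cyl omega n -> 0 <= K omega n;
  sm_drift : forall omega n, 0 < cyl omega n ->
    sumL V (fun w => tr omega n w * K (upd omega (S n) w) (S n)) <= K omega n }.

Fixpoint extend (omega : path) (n : nat) (u : list vtx) : path :=
  match u with
  | [] => omega
  | w :: u' => extend (upd omega (S n) w) (S n) u'
  end.

Fixpoint ext_prob (omega : path) (n : nat) (u : list vtx) : R :=
  match u with
  | [] => 1
  | w :: u' => tr omega n w * ext_prob (upd omega (S n) w) (S n) u'
  end.

Lemma agree_extend u : forall omega n, agree n (extend omega n u) omega.
Proof.
  induction u as [|w u IH]; intros omega n m Hm; [reflexivity|]. simpl.
  rewrite IH by lia. unfold upd. destruct (Nat.eqb_spec m (S n)); [lia|auto].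
Qed.

Lemma cylP_extend u : forall omega n,
  cyl (extend omega n u) (n + length u) = cyl omega n * ext_prob omega n u.
Proof.
  induction u as [|w u IH]; intros omega n; simpl.
  - rewrite Nat.add_0_r; lra.
  - replace (n + S (length u))%nat with (S n + length u)%nat by lia.
    rewrite IH, cylP_upd; lra.
Qed.

(** A word of probability zero counts as a hit: its cylinder enters a covering at no cost, so paths
    outside the support never have to be treated separately. *)
Definition hit (K : path -> nat -> R) (omega : path) (n : nat) : Prop :=
  cyl omega n = 0 \/ 1 <= K omega n.

Lemma hit_adapted K omega omega' n :
  adapted K -> agree n omega omega' -> hit K omega n -> hit K omega' n.
Proof.
  unfold hit. intros HK H. now rewrite (cylP_adapted _ _ _ H), (HK _ _ _ H).
Qed.

Definition first_hit K omega n : Prop :=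
  hit K omega n /\ forall m, (m < n)%nat -> ~ hit K omega m.

(** Conditioning on the next step: a family of words is regrouped by first letter. *)
Lemma sumL_split_head (W : list (list vtx)) (g : vtx -> list vtx -> R) :
  (forall u, In u W -> u <> []) ->
  (forall w u, ~ In w V -> g w u = 0) ->
  sumL W (fun u => match u with [] => 0 | w :: u' => g w u' end) =
  sumL V (fun v => sumL (map (@tl vtx)
    (filter (fun u => match u with [] => false | w :: _ => if vtx_eq_dec w v then true else false end) W)) (g v)).
Proof.
  intros Hne Hg.
  rewrite (sumL_ext V _ (fun v => sumL W (fun u => match u with [] => 0 | w :: u' =>
            if vtx_eq_dec v w then g v u' else 0 end))).
  - rewrite sumL_swap. apply sumL_ext. intros [|w u] Hu; [destruct (Hne _ Hu); auto|].
    rewrite (sumL_indicator vtx_eq_dec V w (fun v => g v u) nodup_verts).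
    destruct in_dec; auto.
  - intros v Hv. rewrite sumL_map, sumL_filter. apply sumL_ext.
    intros [|w u] Hu; auto. destruct (vtx_eq_dec w v); destruct (vtx_eq_dec v w); try congruence.
    reflexivity.
Qed.

(** Optional stopping for finite families of minimal hitting words. If the present word is already a
    hit, minimality leaves at most the empty continuation, of mass 1 <= [K omega n]. Otherwise all
    continuations are nonempty, and one step of [sm_drift] reduces the length bound [M]. *)
Lemma hit_mass_le K (HK : supermartingale K) : forall M omega n (W : list (list vtx)),
  0 < cyl omega n -> NoDup W ->
  (forall u, In u W -> (length u <= M)%nat /\ hit K (extend omega n u) (n + length u) /\
     forall m, (n <= m < n + length u)%nat -> ~ hit K (extend omega n u) m) ->
  sumL W (ext_prob omega n) <= K omega n.
Proof.
  induction M as [|M IH]; intros omega n W Hpos Hnd HW.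
  - assert (HW' : forall u, In u W -> u = [] /\ hit K omega n).
    { intros u Hu. destruct (HW u Hu) as (Hl & Hh & _). destruct u; simpl in *; [|lia].
      rewrite Nat.add_0_r in Hh; auto. }
    destruct W as [|u W]; [apply (sm_nonneg _ HK); auto|].
    destruct (HW' u (or_introl eq_refl)) as [-> [H|H]]; [lra|].
    destruct W as [|u' W]; [unfold sumL; simpl; lra|]. exfalso.
    destruct (HW' u' (or_intror (or_introl eq_refl))) as [-> _].
    inversion Hnd; subst. apply H2; left; auto.
  - destruct (classic (hit K omega n)) as [Hh|Hh].
    + assert (HW' : forall u, In u W -> u = []).
      { intros u Hu. destruct (HW u Hu) as (_ & _ & H). destruct u; auto. exfalso.
        apply (H n); [simpl; lia|]. apply hit_adapted with omega; auto; [apply HK|].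
        intros m Hm; symmetry; now apply agree_extend. }
      destruct W as [|u W]; [apply (sm_nonneg _ HK); auto|].
      rewrite (HW' u (or_introl eq_refl)) in *. destruct Hh as [H|H]; [lra|].
      destruct W as [|u' W]; [unfold sumL; simpl; lra|]. exfalso.
      rewrite (HW' u' (or_intror (or_introl eq_refl))) in *.
      inversion Hnd; subst. apply H2; left; auto.
    + assert (HW' : forall u, In u W -> u <> []).
      { intros u Hu ->. destruct (HW _ Hu) as (_ & H & _). simpl in H. rewrite Nat.add_0_r in H; auto. }
      apply Rle_trans with (2 := sm_drift _ HK omega n Hpos).
      rewrite (sumL_ext W _ (fun u => match u with [] => 0 | w :: u' =>
         tr omega n w * ext_prob (upd omega (S n) w) (S n) u' end)).
      2:{ intros [|w u] Hu; [destruct (HW' _ Hu); auto|reflexivity]. }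
      rewrite (sumL_split_head W (fun w u' => tr omega n w * ext_prob (upd omega (S n) w) (S n) u')); auto.
      2:{ intros w u Hw. rewrite trans_outside; auto; lra. }
      apply sumL_le. intros v Hv. rewrite sumL_scal.
      destruct (trans_nonneg omega n v) as [Ht|Ht]; [|rewrite <- Ht; lra].
      apply Rmult_le_compat_l; [lra|]. apply IH.
      * rewrite cylP_upd. now apply Rmult_lt_0_compat.
      (* All words kept by the filter begin with [v], so removing the head is injective on them and
         the tails stay distinct. *)
      * assert (Hin : forall u, In u (filter (fun u => match u with [] => false | w :: _ =>
           if vtx_eq_dec w v then true else false end) W) -> exists u', u = v :: u').
        { intros u Hu. apply filter_In in Hu. destruct Hu as [_ Hu]. destruct u as [|w u]; [discriminate|].
          destruct (vtx_eq_dec w v); [subst; eauto|discriminate]. }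
        pose proof (NoDup_filter (fun u => match u with [] => false | w :: _ =>
           if vtx_eq_dec w v then true else false end) Hnd) as Hf.
        revert Hin Hf. generalize (filter (fun u => match u with [] => false | w :: _ =>
           if vtx_eq_dec w v then true else false end) W). clear.
        intros l Hin. induction 1 as [|x l Hx Hl IH]; simpl; constructor.
        -- intros H. apply in_map_iff in H. destruct H as (y & Hy & Hyl). apply Hx.
           destruct (Hin y (or_intror Hyl)) as (y' & ->).
           destruct (Hin x (or_introl eq_refl)) as (x' & ->). simpl in Hy. now subst.
        -- apply IH. intros u Hu; apply Hin; right; auto.
      * intros u Hu. apply in_map_iff in Hu. destruct Hu as (u' & <- & Hu).
        apply filter_In in Hu. destruct Hu as [Hu Hv']. destruct u' as [|w u]; [discriminate|].
        destruct (vtx_eq_dec w v); [subst w|discriminate].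
        destruct (HW _ Hu) as (Hl & Hh' & Hn). simpl in *.
        replace (n + S (length u))%nat with (S (n + length u))%nat in * by lia.
        split; [lia|split; auto]. intros m Hm; apply Hn; lia.
Qed.


(** * Coverings indexed by codes of words, and Ville's inequality *)

Definition code_vtx (v : vtx) : nat :=
  match v with Int i => to_nat (0%nat, i) | Leaf i k => to_nat (S i, k) end.

Fixpoint code (l : list vtx) : nat :=
  match l with [] => 0%nat | a :: u => S (to_nat (code_vtx a, code u)) end.

Lemma code_inj l : forall l', code l = code l' -> l = l'.
Proof.
  induction l as [|a u IH]; intros [|b u']; cbn [code]; intros H; try discriminate; auto.
  apply Nat.succ_inj, to_nat_inj in H. apply pair_equal_spec in H. destruct H as [Ha Hu].
  f_equal; auto. destruct a, b; cbn [code_vtx] in Ha; apply to_nat_inj in Ha; congruence.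
Qed.

Definition good_word K (l : list vtx) : Prop :=
  match l with
  | [] => False
  | a :: u => first_hit K (extend (fun _ => a) 0 u) (length u)
  end.

(* The cylinder at [fun _ => off_start] of length 0 has probability zero; it pads
   the enumeration at the indices that code no first hitting word. *)
Definition off_start : vtx := match x0 with Int _ => Leaf 0 0 | Leaf _ _ => Int 0 end.

Lemma off_start_neq : off_start <> x0.
Proof. unfold off_start; destruct x0; discriminate. Qed.

Definition cover_cyl K (k : nat) : path * nat :=
  match excluded_middle_informative (exists l, code l = k /\ good_word K l) with
  | left H =>
      match proj1_sig (constructive_indefinite_description _ H) with
      | [] => (fun _ => off_start, 0%nat)
      | a :: u => (extend (fun _ => a) 0 u, length u)
      end
  | right _ => (fun _ => off_start, 0%nat)
  end.

Lemma cover_cyl_code K a u : good_word K (a :: u) ->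
  cover_cyl K (code (a :: u)) = (extend (fun _ => a) 0 u, length u).
Proof.
  intros Hg. unfold cover_cyl. destruct excluded_middle_informative as [H|H].
  - destruct constructive_indefinite_description as (l & Hl & Hgl). cbn [proj1_sig].
    apply code_inj in Hl. now subst l.
  - destruct H. eauto.
Qed.

(** Only words starting at [x0] carry mass, and for them the probability of the cylinder is the
    continuation probability from time 0. *)
Lemma cover_cyl_cases K k :
  cylP d r z0 x0 (fst (cover_cyl K k)) (snd (cover_cyl K k)) = 0 \/
  exists u, k = code (x0 :: u) /\ good_word K (x0 :: u) /\
    cylP d r z0 x0 (fst (cover_cyl K k)) (snd (cover_cyl K k)) = ext_prob (fun _ => x0) 0 u.
Proof.
  assert (H0 : cylP d r z0 x0 (fun _ => off_start) 0 = 0).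
  { simpl. destruct vtx_eq_dec as [e|]; auto. destruct (off_start_neq e). }
  destruct (classic (exists l, code l = k /\ good_word K l)) as [(l & <- & Hg)|H].
  - destruct l as [|a u]; [destruct Hg|]. rewrite cover_cyl_code by auto.
    cbn [fst snd]. pose proof (cylP_extend u (fun _ => a) 0) as E. rewrite Nat.add_0_l in E.
    unfold cyl in E. rewrite E. destruct (vtx_eq_dec a x0) as [->|Hne].
    + right. exists u. split; auto. split; auto. simpl. destruct vtx_eq_dec; [lra|congruence].
    + left. simpl. destruct vtx_eq_dec; [congruence|lra].
  - left. unfold cover_cyl. destruct excluded_middle_informative as [H'|_]; [contradiction|]. exact H0.
Qed.

Lemma extend_path omega m : forall omega' k, agree k omega' omega ->
  agree (k + m) (extend omega' k (map omega (seq (S k) m))) omega.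
Proof.
  induction m as [|m IH]; intros omega' k H; simpl.
  - now rewrite Nat.add_0_r.
  - replace (k + S m)%nat with (S k + m)%nat by lia. apply IH.
    intros j Hj. unfold upd. destruct (Nat.eqb_spec j (S k)); [congruence|]. apply H; lia.
Qed.

Lemma hit_first_hit K omega n : hit K omega n -> exists m, first_hit K omega m.
Proof.
  induction n as [n IH] using lt_wf_ind. intros H.
  destruct (classic (exists m, (m < n)%nat /\ hit K omega m)) as [(m & Hm & Hh)|Hn].
  - now apply (IH m).
  - exists n. split; auto. intros m Hm Hh. apply Hn; eauto.
Qed.

(* Ville's inequality: the minimal hitting words are prefix free, and their total
   probability is at most the initial capital. *)
Lemma ville_cover K eps : supermartingale K -> 0 < eps ->
  (forall omega, omega 0%nat = x0 -> K omega 0%nat <= eps) ->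
  exists (c : nat -> path) (len : nat -> nat),
    (forall omega n, hit K omega n -> exists k, in_cyl (c k) (len k) omega) /\
    (forall N, sum_f_R0 (fun k => cylP d r z0 x0 (c k) (len k)) N <= eps).
Proof.
  intros HK Heps Hroot.
  exists (fun k => fst (cover_cyl K k)), (fun k => snd (cover_cyl K k)). split.
  - intros omega n Hh. destruct (hit_first_hit _ _ _ Hh) as (m & Hm & Hlt).
    set (u := map omega (seq 1 m)).
    assert (Hl : length u = m) by (unfold u; now rewrite length_map, length_seq).
    assert (Ha : agree m (extend (fun _ => omega 0%nat) 0 u) omega).
    { apply (extend_path omega m (fun _ => omega 0%nat) 0). intros j Hj. f_equal; lia. }
    assert (Hg : good_word K (omega 0%nat :: u)).
    { simpl. rewrite Hl. split.
      - apply hit_adapted with omega; auto; [apply HK|]. intros j Hj; symmetry; auto.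
      - intros j Hj H. apply (Hlt j Hj). revert H. apply hit_adapted; [apply HK|].
        intros i Hi; apply Ha; lia. }
    exists (code (omega 0%nat :: u)). rewrite cover_cyl_code by auto. simpl. rewrite Hl.
    intros j Hj. symmetry; auto.
  - intros N. rewrite <- sumL_seq_sum_f_R0.
    (* Distinct indices that carry mass decode to distinct continuations of [x0], so every partial
       sum is bounded by the mass of a finite family to which [hit_mass_le] applies. *)
    assert (H : forall ks, NoDup ks -> exists W, NoDup W /\
       (forall u, In u W -> good_word K (x0 :: u) /\ In (code (x0 :: u)) ks) /\
       sumL ks (fun k => cylP d r z0 x0 (fst (cover_cyl K k)) (snd (cover_cyl K k)))
         <= sumL W (ext_prob (fun _ => x0) 0)).
    { induction 1 as [|k ks Hk Hks (W & HW & HW' & Hs)].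
      - exists []. split; [constructor|]. split; [intros u []|apply Rle_refl].
      - destruct (cover_cyl_cases K k) as [H0|(u & Eu & Hg & E)].
        + exists W. split; auto. split; [|rewrite sumL_cons, H0; lra].
          intros u Hu; destruct (HW' u Hu); split; auto. right; auto.
        + exists (u :: W). split; [constructor; auto; intros Hu; destruct (HW' u Hu); congruence|].
          split; [|rewrite !sumL_cons, E; lra]. intros u' [<-|Hu]; [split; auto; left; auto|].
          destruct (HW' u' Hu); split; auto; right; auto. }
    destruct (H (seq 0 (S N)) (seq_NoDup _ _)) as (W & HW & HW' & Hs).
    apply Rle_trans with (1 := Hs). apply Rle_trans with (K (fun _ => x0) 0%nat); [|auto].
    apply (hit_mass_le K HK (list_max (map (@length vtx) W))); auto.
    + unfold cyl; simpl. destruct vtx_eq_dec; [lra|congruence].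
    + intros u Hu. split.
      * pose proof (proj1 (list_max_le (map (@length vtx) W) _) (le_n _)) as Hf.
        rewrite Forall_forall in Hf. apply Hf. now apply in_map.
      * destruct (HW' u Hu) as [[Hh Hn] _]. split; auto. intros m Hm. apply Hn; lia.
Qed.

(** * Null sets and almost sure events *)

Lemma null_of_capital (A : path -> Prop) :
  (forall eps, 0 < eps -> exists K, supermartingale K /\
     (forall omega, omega 0%nat = x0 -> K omega 0%nat <= eps) /\
     (forall omega, A omega -> exists n, hit K omega n)) ->
  vrrw_null d r z0 x0 A.
Proof.
  intros H eps Heps. destruct (H eps Heps) as (K & HK & Hroot & HA).
  destruct (ville_cover K eps HK Heps Hroot) as (c & len & Hc & Hs).
  exists c, len. split; auto. intros omega Ho. destruct (HA _ Ho) as (n & Hn). eauto.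
Qed.

Lemma null_subset (A B : path -> Prop) :
  (forall omega, A omega -> B omega) -> vrrw_null d r z0 x0 B -> vrrw_null d r z0 x0 A.
Proof.
  intros HAB HB eps Heps. destruct (HB eps Heps) as (c & len & Hc & Hs).
  exists c, len. split; auto.
Qed.

Lemma geom_sum N : sumL (seq 0 N) (fun i => (/ 2) ^ S i) <= 1.
Proof.
  enough (sumL (seq 0 N) (fun i => (/ 2) ^ S i) = 1 - (/ 2) ^ N) by
    (pose proof (pow_lt (/ 2) N ltac:(lra)); lra).
  induction N; [unfold sumL; simpl; lra|].
  rewrite seq_S, sumL_app, IHN. unfold sumL; simpl; lra.
Qed.

(** The i-th set receives the share eps / 2^(i+1), and Cantor pairing merges the coverings into one
    sequence. *)
Lemma null_union (A : nat -> path -> Prop) :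
  (forall i, vrrw_null d r z0 x0 (A i)) ->
  vrrw_null d r z0 x0 (fun omega => exists i, A i omega).
Proof.
  intros HA eps Heps.
  assert (Hch : forall i, exists p : (nat -> path) * (nat -> nat),
     (forall omega, A i omega -> exists k, in_cyl (fst p k) (snd p k) omega) /\
     (forall N, sum_f_R0 (fun k => cylP d r z0 x0 (fst p k) (snd p k)) N <= eps * (/ 2) ^ S i)).
  { intros i. destruct (HA i (eps * (/ 2) ^ S i)) as (c & len & H1 & H2).
    - apply Rmult_lt_0_compat; auto. apply pow_lt; lra.
    - exists (c, len); auto. }
  set (p := fun i => proj1_sig (constructive_indefinite_description _ (Hch i))).
  assert (Hp : forall i, (forall omega, A i omega -> exists k, in_cyl (fst (p i) k) (snd (p i) k) omega) /\
     (forall N, sum_f_R0 (fun k => cylP d r z0 x0 (fst (p i) k) (snd (p i) k)) N <= eps * (/ 2) ^ S i)).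
  { intros i. exact (proj2_sig (constructive_indefinite_description _ (Hch i))). }
  clearbody p.
  exists (fun k => fst (p (fst (of_nat k))) (snd (of_nat k))),
         (fun k => snd (p (fst (of_nat k))) (snd (of_nat k))).
  split.
  - intros omega (i & Hi). destruct (proj1 (Hp i) _ Hi) as (k & Hk).
    exists (to_nat (i, k)). now rewrite cancel_of_to.
  - intros N. rewrite <- sumL_seq_sum_f_R0.
    set (f := fun q : nat * nat => cylP d r z0 x0 (fst (p (fst q)) (snd q)) (snd (p (fst q)) (snd q))).
    change (sumL (seq 0 (S N)) (fun k => f (of_nat k)) <= eps).
    rewrite <- (sumL_map of_nat).
    (* A Cantor code dominates both of its components, so the codes up to [N] lie in this square;
       the additional cells have nonnegative mass. *)
    apply Rle_trans with (sumL (list_prod (seq 0 (S N)) (seq 0 (S N))) f).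
    { apply sumL_incl.
      - apply Injective_map_NoDup; [|apply seq_NoDup]. intros a b E.
        rewrite <- (cancel_to_of a), <- (cancel_to_of b), E; auto.
      - intros [i j] H. apply in_map_iff in H. destruct H as (k & E & Hk). apply in_seq in Hk.
        pose proof (to_nat_non_decreasing i j) as Hle. rewrite <- E, cancel_to_of in Hle.
        apply in_prod; apply in_seq; lia.
      - intros q. apply cylP_nonneg. }
    rewrite list_prod_as_flat_map, sumL_flat_map.
    apply Rle_trans with (sumL (seq 0 (S N)) (fun i => eps * (/ 2) ^ S i)).
    { apply sumL_le. intros i _. rewrite sumL_map, sumL_seq_sum_f_R0. apply (proj2 (Hp i)). }
    rewrite sumL_scal. pose proof (geom_sum (S N)). nra.
Qed.

Lemma as_impl (E E' : path -> Prop) :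
  (forall omega, E omega -> E' omega) -> vrrw_as d r z0 x0 E -> vrrw_as d r z0 x0 E'.
Proof. intros H. apply null_subset. auto. Qed.

Lemma as_forall (E : nat -> path -> Prop) :
  (forall i, vrrw_as d r z0 x0 (E i)) -> vrrw_as d r z0 x0 (fun omega => forall i, E i omega).
Proof.
  intros H. apply null_subset with (2 := null_union _ H).
  intros omega Hn. now apply not_all_ex_not.
Qed.

Lemma as_and (E E' : path -> Prop) :
  vrrw_as d r z0 x0 E -> vrrw_as d r z0 x0 E' -> vrrw_as d r z0 x0 (fun omega => E omega /\ E' omega).
Proof.
  intros H H'.
  apply as_impl with (fun omega => forall i, (if Nat.eqb i 0 then E else E') omega).
  - intros omega Ho. split; [apply (Ho 0%nat)|apply (Ho 1%nat)].
  - apply as_forall. intros i. now destruct Nat.eqb.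
Qed.

(** The capital identically 0 is enough: by the definition of [hit], reaching a word of probability
    zero already counts. *)
Lemma as_cylP_pos : vrrw_as d r z0 x0 (fun omega => forall n, 0 < cyl omega n).
Proof.
  apply null_of_capital. intros eps Heps. exists (fun _ _ => 0). split; [|split].
  - split; [intros ? ? ? _; reflexivity|intros; lra|].
    intros omega n _. rewrite (sumL_ext V _ (fun _ => 0)) by (intros; lra).
    rewrite sumL_const; lra.
  - intros; lra.
  - intros omega H. apply not_all_ex_not in H. destruct H as (n & Hn). exists n. left.
    destruct (cylP_nonneg omega n); [contradiction|auto].
Qed.

Lemma sm_root K omega omega' : supermartingale K ->
  omega 0%nat = x0 -> omega' 0%nat = x0 -> K omega 0%nat = K omega' 0%nat.
Proof.
  intros HK H H'. apply HK. intros m Hm. replace m with 0%nat by lia. congruence.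
Qed.

(** * Almost sure convergence of nonnegative supermartingales *)

Lemma as_sm_bounded Q : supermartingale Q ->
  vrrw_as d r z0 x0 (fun omega => exists B, forall n, Q omega n <= B).
Proof.
  intros HQ. apply null_of_capital. intros eps Heps.
  set (q := Q (fun _ => x0) 0%nat).
  assert (Hq : 0 <= q).
  { apply (sm_nonneg _ HQ). unfold cyl; simpl; destruct vtx_eq_dec; [lra|congruence]. }
  (* The bet is [s * Q], which passes 1 on any path where [Q] is unbounded. The [+ 1] covers
     [q = 0]. *)
  set (s := eps / (q + 1)).
  assert (Hs : 0 < s) by (apply Rdiv_lt_0_compat; lra).
  assert (Hsq : s * (q + 1) = eps) by (unfold s; field; lra).
  exists (fun omega n => s * Q omega n). split; [|split].
  - split.
    + intros o o' n H. now rewrite (sm_adapted _ HQ o o' n H).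
    + intros o n H. apply Rmult_le_pos; [lra|]. now apply (sm_nonneg _ HQ).
    + intros o n H. rewrite (sumL_ext V _ (fun w => s * (tr o n w * Q (upd o (S n) w) (S n))))
        by (intros; ring).
      rewrite sumL_scal. apply Rmult_le_compat_l; [lra|]. now apply (sm_drift _ HQ).
  - intros o Ho. rewrite (sm_root Q o (fun _ => x0) HQ Ho eq_refl). fold q. nra.
  - intros o Ho. apply NNPP. intros Hn. apply Ho. exists (/ s). intros n.
    destruct (Rle_or_lt (Q o n) (/ s)) as [|H]; auto. destruct Hn. exists n. right.
    apply (Rmult_lt_compat_l s) in H; auto. rewrite Rinv_r in H; lra.
Qed.

(* Upcrossing strategy: the boolean says whether the gambler currently holds
   shares of price [Q]; the real is the number of shares, respectively the cash. *)
Fixpoint strategy (Q : path -> nat -> R) (a b k0 : R) (omega : path) (n : nat) : bool * R :=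
  match n with
  | O => (false, k0)
  | S m =>
      let q := Q omega (S m) in
      match strategy Q a b k0 omega m with
      | (true, u) => if Rle_dec b q then (false, u * q) else (true, u)
      | (false, u) => if Rle_dec q a then (true, u / a) else (false, u)
      end
  end.

Definition wealth (s : bool * R) (q : R) : R := if fst s then snd s * q else snd s.

Lemma strategy_adapted Q a b k0 : adapted Q -> adapted (strategy Q a b k0).
Proof.
  intros HQ o o' n; induction n; intros H; [reflexivity|]. simpl.
  rewrite IHn by (intros m Hm; apply H; lia). now rewrite (HQ o o' (S n) H).
Qed.

Lemma strategy_nonneg Q a b k0 omega n : supermartingale Q -> 0 < a -> 0 <= k0 ->
  0 < cyl omega n -> 0 <= snd (strategy Q a b k0 omega n).
Proof.
  intros HQ Ha Hk. induction n; intros Hc; simpl; auto.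
  pose proof (IHn (proj1 (cylP_S_pos _ _ Hc))) as H.
  pose proof (sm_nonneg _ HQ _ _ Hc) as Hq.
  destruct strategy as [[] u]; simpl in H.
  - destruct Rle_dec; simpl; auto. now apply Rmult_le_pos.
  - destruct Rle_dec; simpl; auto. apply Rmult_le_pos; auto. left; now apply Rinv_0_lt_compat.
Qed.

(** A sale leaves the wealth unchanged. A purchase is booked at the price [a] although the price is
    at most [a], which can only lose wealth. Between trades the wealth is a fixed multiple of [Q],
    or constant cash; cash is where total transition mass at most 1 enters. *)
Lemma wealth_supermartingale Q a b k0 :
  (forall omega n, 0 < cyl omega n -> sumL V (tr omega n) <= 1) ->
  supermartingale Q -> 0 < a -> 0 <= k0 ->
  supermartingale (fun omega n => wealth (strategy Q a b k0 omega n) (Q omega n)).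
Proof.
  intros Htr HQ Ha Hk. split.
  - intros o o' n H. rewrite (strategy_adapted Q a b k0 (sm_adapted _ HQ) o o' n H).
    now rewrite (sm_adapted _ HQ o o' n H).
  - intros o n Hc. pose proof (strategy_nonneg Q a b k0 o n HQ Ha Hk Hc) as H.
    unfold wealth. destruct (fst _); auto. apply Rmult_le_pos; auto. now apply (sm_nonneg _ HQ).
  - intros o n Hc. pose proof (strategy_nonneg Q a b k0 o n HQ Ha Hk Hc) as Hs.
    apply Rle_trans with (sumL V (fun w => tr o n w *
       wealth (strategy Q a b k0 o n) (Q (upd o (S n) w) (S n)))).
    + apply sumL_le. intros w _.
      destruct (trans_nonneg o n w) as [Ht|Ht]; [|rewrite <- Ht; lra].
      apply Rmult_le_compat_l; [lra|].
      assert (Hcw : 0 < cyl (upd o (S n) w) (S n)) by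
        (rewrite cylP_upd; now apply Rmult_lt_0_compat).
      pose proof (sm_nonneg _ HQ _ _ Hcw) as Hq. simpl.
      rewrite (strategy_adapted Q a b k0 (sm_adapted _ HQ) (upd o (S n) w) o n) by
        (apply agree_upd; lia).
      destruct strategy as [[] u]; simpl in Hs; destruct Rle_dec; unfold wealth; simpl; try lra.
      replace u with (u / a * a) at 2 by (field; lra).
      apply Rmult_le_compat_l; auto. apply Rmult_le_pos; auto. left; now apply Rinv_0_lt_compat.
    + destruct strategy as [[] u]; unfold wealth; simpl in *.
      * rewrite (sumL_ext V _ (fun w => u * (tr o n w * Q (upd o (S n) w) (S n)))) by (intros; ring).
        rewrite sumL_scal. apply Rmult_le_compat_l; auto. now apply (sm_drift _ HQ).
      * rewrite (sumL_ext V _ (fun w => u * tr o n w)) by (intros; ring).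
        rewrite sumL_scal. pose proof (Htr o n Hc). nra.
Qed.

(** Without a further trade the state would stay constant, although [Q] later returns below [a], or
    above [b]. So round trips never stop, and each multiplies the cash by at least [b / a]. *)
Lemma strategy_upcrossings Q a b k0 omega : 0 < a -> a < b -> 0 < k0 ->
  (forall N, exists n, (N <= n)%nat /\ Q omega n <= a) ->
  (forall N, exists n, (N <= n)%nat /\ b <= Q omega n) ->
  forall i, exists n u, strategy Q a b k0 omega n = (false, u) /\ k0 * (b / a) ^ i <= u.
Proof.
  intros Ha Hab Hk Hlo Hhi i.
  assert (Hba : 0 < b / a) by (apply Rdiv_lt_0_compat; lra).
  induction i as [|i (n & u & Hn & Hu)].
  - exists 0%nat, k0. split; auto. simpl; lra.
  - assert (Hu0 : 0 < u) by (pose proof (pow_lt _ i Hba); nra).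
    assert (Hbuy : exists m, strategy Q a b k0 omega m = (true, u / a)).
    { destruct (Hlo (S n)) as (m & Hm & Hq). apply NNPP. intros Hno.
      assert (Hst : forall j, (n <= j)%nat -> strategy Q a b k0 omega j = (false, u)).
      { intros j Hj. induction Hj as [|j Hj IHj]; auto. simpl. rewrite IHj.
        destruct Rle_dec; auto. destruct Hno. exists (S j). simpl. rewrite IHj.
        destruct Rle_dec; auto; contradiction. }
      destruct Hno. destruct m as [|m]; [lia|]. exists (S m). simpl.
      rewrite Hst by lia. destruct Rle_dec; auto; contradiction. }
    destruct Hbuy as (m & Hm).
    assert (Hsell : exists j, strategy Q a b k0 omega j = (false, u / a * Q omega j) /\ b <= Q omega j).
    { destruct (Hhi (S m)) as (j & Hj & Hq). apply NNPP. intros Hno.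
      assert (Hst : forall l, (m <= l)%nat -> strategy Q a b k0 omega l = (true, u / a)).
      { intros l Hl. induction Hl as [|l Hl IHl]; auto. simpl. rewrite IHl.
        destruct Rle_dec; auto. destruct Hno. exists (S l). simpl. rewrite IHl.
        destruct Rle_dec; auto; contradiction. }
      destruct Hno. destruct j as [|j]; [lia|]. exists (S j). simpl.
      rewrite Hst by lia. destruct Rle_dec; auto; contradiction. }
    destruct Hsell as (j & Hj & Hq). exists j, (u / a * Q omega j). split; auto.
    apply Rle_trans with (u / a * b).
    + replace (k0 * (b / a) ^ S i) with (k0 * (b / a) ^ i * (b / a)) by (simpl; ring).
      replace (u / a * b) with (u * (b / a)) by (field; lra).
      apply Rmult_le_compat_r; lra.
    + apply Rmult_le_compat_l; auto. apply Rmult_le_pos; [lra|]. left; now apply Rinv_0_lt_compat.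
Qed.

Lemma as_no_upcrossings Q a b :
  (forall omega n, 0 < cyl omega n -> sumL V (tr omega n) <= 1) ->
  supermartingale Q -> 0 < a -> a < b ->
  vrrw_as d r z0 x0 (fun omega => ~ ((forall N, exists n, (N <= n)%nat /\ Q omega n <= a) /\
    (forall N, exists n, (N <= n)%nat /\ b <= Q omega n))).
Proof.
  intros Htr HQ Ha Hab. apply null_of_capital. intros eps Heps.
  exists (fun omega n => wealth (strategy Q a b eps omega n) (Q omega n)). split; [|split].
  - apply wealth_supermartingale; auto; lra.
  - intros o _. unfold wealth; simpl; lra.
  - intros o H. apply NNPP in H. destruct H as [Hlo Hhi].
    assert (Hba : 1 < b / a) by (apply (Rmult_lt_reg_r a); auto; unfold Rdiv;
      rewrite Rmult_assoc, Rinv_l; lra).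
    destruct (Pow_x_infinity (b / a)) with (b := / eps) as (i & Hi).
    { rewrite Rabs_pos_eq; lra. }
    destruct (strategy_upcrossings Q a b eps o Ha Hab Heps Hlo Hhi i) as (n & u & Hn & Hu).
    exists n. right. rewrite Hn. unfold wealth; simpl.
    specialize (Hi i (le_n _)). rewrite Rabs_pos_eq in Hi by (apply pow_le; lra).
    apply Rge_le, (Rmult_le_compat_l eps) in Hi; [|lra]. rewrite Rinv_r in Hi; lra.
Qed.

(** On a grid of mesh h < eps / 4, each pair of adjacent levels (p + 1) h, (p + 2) h is eventually
    respected on one side. Finitely many levels reach [B], so one [N] serves them all. If p h <= u n
    < (p + 1) h with n >= N, the values from [N] on stay below (p + 2) h, hence rise above u n by
    less than 2 h. Levels start at h because the betting strategy divides by the lower level. *)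
Lemma Un_cv_of_no_upcrossings (u : nat -> R) B :
  (forall n, 0 <= u n <= B) ->
  (forall p q : nat, ~ ((forall N, exists n, (N <= n)%nat /\ u n <= INR (S p) / INR (S q)) /\
    (forall N, exists n, (N <= n)%nat /\ INR (S (S p)) / INR (S q) <= u n))) ->
  exists l, Un_cv u l.
Proof.
  intros HB Hup. destruct (R_complete u) as (l & Hl); [|eauto].
  intros eps Heps.
  destruct (archimed_cor1 (eps / 4)) as (q & Hq & Hq0); [lra|].
  destruct q as [|q]; [lia|]. set (h := / INR (S q)) in *.
  assert (Hh : 0 < h) by (apply Rinv_0_lt_compat, lt_0_INR; lia).
  assert (Hp : forall p, exists N, (forall n, (N <= n)%nat -> INR (S p) * h < u n) \/
                                   (forall n, (N <= n)%nat -> u n < INR (S (S p)) * h)).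
  { intros p. apply NNPP. intros Hn. apply (Hup p q). split; intros N; apply NNPP; intros H;
      apply Hn; exists N; [left|right]; intros n HNn; apply Rnot_le_lt; intros Hle; apply H; eauto. }
  assert (HN : forall P, exists N, forall p, (p <= P)%nat ->
     (forall n, (N <= n)%nat -> INR (S p) * h < u n) \/
     (forall n, (N <= n)%nat -> u n < INR (S (S p)) * h)).
  { induction P as [|P (N & HN)].
    - destruct (Hp 0%nat) as (N & HN). exists N. intros p Hp0. now replace p with 0%nat by lia.
    - destruct (Hp (S P)) as (N' & HN'). exists (N + N')%nat. intros p Hp1.
      destruct (Nat.eq_dec p (S P)) as [->|].
      + destruct HN' as [H|H]; [left|right]; intros; apply H; lia.
      + destruct (HN p) as [H|H]; [lia|left|right]; intros; apply H; lia. }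
  destruct (INR_unbounded (B / h)) as (P & HP).
  destruct (HN P) as (N & HNP). exists N.
  assert (HPB : B < INR P * h).
  { apply (Rmult_lt_compat_r h) in HP; auto. unfold Rdiv in HP. rewrite Rmult_assoc, Rinv_l in HP; lra. }
  assert (Hnm : forall n m, (N <= n)%nat -> (N <= m)%nat -> u m - u n < eps).
  { intros n m Hn Hm. destruct (Rlt_or_le (u m - u n) eps) as [|H]; auto. exfalso.
    pose proof (HB n) as HBn.
    assert (Hfloor : forall k, u n < INR (S k) * h ->
       exists p, (p <= k)%nat /\ u n < INR (S p) * h /\ INR p * h <= u n).
    { induction k as [|k IHk]; intros Hk.
      - exists 0%nat. split; auto. split; auto. simpl; lra.
      - destruct (Rlt_or_le (u n) (INR (S k) * h)) as [Hlt|Hle].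
        + destruct (IHk Hlt) as (p & ? & ?). exists p; auto.
        + exists (S k); auto. }
    destruct (Hfloor P) as (p & HpP & Hp1 & Hp2); [rewrite S_INR; lra|].
    pose proof (S_INR p) as E1. pose proof (S_INR (S p)) as E2.
    destruct (HNP p HpP) as [Hl|Hr].
    - specialize (Hl n Hn). lra.
    - specialize (Hr m Hm). rewrite E2, E1 in Hr. nra. }
  intros n m Hn Hm. unfold Rdist. apply Rabs_def1.
  - apply Hnm; auto.
  - pose proof (Hnm n m Hn Hm). lra.
Qed.

(** Doob's convergence theorem. Rational grid levels make the exceptional set a countable union. *)
Lemma supermartingale_cv Q :
  (forall omega n, 0 < cyl omega n -> sumL V (tr omega n) <= 1) ->
  supermartingale Q -> vrrw_as d r z0 x0 (fun omega => exists l, Un_cv (Q omega) l).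
Proof.
  intros Htr HQ.
  set (E := fun p q omega => ~ ((forall N, exists n, (N <= n)%nat /\ Q omega n <= INR (S p) / INR (S q)) /\
    (forall N, exists n, (N <= n)%nat /\ INR (S (S p)) / INR (S q) <= Q omega n))).
  apply as_impl with (fun omega => (forall n, 0 < cyl omega n) /\ (exists B, forall n, Q omega n <= B) /\
    forall p q, E p q omega).
  - intros o (Hc & (B & HB) & HE). apply Un_cv_of_no_upcrossings with B; auto.
    intros n; split; auto. now apply (sm_nonneg _ HQ).
  - apply as_and; [apply as_cylP_pos|]. apply as_and; [now apply as_sm_bounded|].
    apply as_forall; intros p. apply as_forall; intros q.
    assert (Hq : 0 < INR (S q)) by (apply lt_0_INR; lia).
    assert (Hp : 0 < INR (S p)) by (apply lt_0_INR; lia).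
    apply as_no_upcrossings; auto.
    + now apply Rdiv_lt_0_compat.
    + apply Rmult_lt_compat_r; [now apply Rinv_0_lt_compat|]. apply lt_INR; lia.
Qed.

End Walk.

(** * Drift of the Lyapunov function *)

Definition sumN (d : nat) (f : nat -> R) : R := sumL (seq 0 d) f.

Lemma sumN_ext d f g : (forall j, (j < d)%nat -> f j = g j) -> sumN d f = sumN d g.
Proof. intros H; apply sumL_ext; intros j Hj; apply H. apply in_seq in Hj; lia. Qed.

Lemma sumN_le d f g : (forall j, (j < d)%nat -> f j <= g j) -> sumN d f <= sumN d g.
Proof. intros H; apply sumL_le; intros j Hj; apply H. apply in_seq in Hj; lia. Qed.

Lemma sumN_nonneg d f : (forall j, (j < d)%nat -> 0 <= f j) -> 0 <= sumN d f.
Proof. intros H; apply sumL_nonneg; intros j Hj; apply H. apply in_seq in Hj; lia. Qed.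

Lemma sumN_const d c : sumN d (fun _ => c) = INR d * c.
Proof. unfold sumN. now rewrite sumL_const, length_seq. Qed.

Lemma sumN_plus d f g : sumN d (fun j => f j + g j) = sumN d f + sumN d g.
Proof. apply sumL_plus. Qed.

Lemma sumN_scal d c f : sumN d (fun j => c * f j) = c * sumN d f.
Proof. apply sumL_scal. Qed.

Lemma sumN_single d k f : (k < d)%nat -> sumN d (fun j => if Nat.eqb j k then f j else 0) = f k.
Proof.
  intros H. unfold sumN.
  rewrite (sumL_ext _ _ (fun j => if Nat.eq_dec j k then f j else 0)).
  - rewrite sumL_indicator by apply seq_NoDup. destruct in_dec as [|n]; auto.
    destruct n; apply in_seq; lia.
  - intros j _. destruct (Nat.eqb_spec j k), (Nat.eq_dec j k); congruence || auto.
Qed.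

Lemma sumN_except d k f : (k < d)%nat ->
  sumN d (fun j => if Nat.eqb j k then 0 else f j) = sumN d f - f k.
Proof.
  intros H. rewrite <- (sumN_single d k f H).
  rewrite (sumN_ext d f (fun j => (if Nat.eqb j k then f j else 0) + (if Nat.eqb j k then 0 else f j))) at 1.
  - rewrite sumN_plus; lra.
  - intros j _. destruct Nat.eqb; lra.
Qed.

Lemma sumN_term_le d k f : (k < d)%nat -> (forall j, (j < d)%nat -> 0 <= f j) -> f k <= sumN d f.
Proof.
  intros Hk H. pose proof (sumN_except d k f Hk).
  enough (0 <= sumN d (fun j => if Nat.eqb j k then 0 else f j)) by lra.
  apply sumN_nonneg. intros j Hj. destruct Nat.eqb; auto; lra.
Qed.

(** * Configurations, corrector and Lyapunov function *)

Definition bump (Z : nat -> R) (k : nat) : nat -> R :=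
  fun j => if Nat.eqb j k then Z j + 1 else Z j.

Lemma bump_eq Z k : bump Z k k = Z k + 1.
Proof. unfold bump. now rewrite Nat.eqb_refl. Qed.

Lemma sumN_bump d k Z (f : R -> R) : (k < d)%nat ->
  sumN d (fun j => f (bump Z k j)) = sumN d (fun j => f (Z j)) + (f (Z k + 1) - f (Z k)).
Proof.
  intros Hk.
  rewrite <- (sumN_single d k (fun j => f (Z j + 1) - f (Z j)) Hk), <- sumN_plus.
  apply sumN_ext. intros j _. unfold bump. destruct Nat.eqb; lra.
Qed.

Lemma sumN_bump_id d k Z : (k < d)%nat -> sumN d (bump Z k) = sumN d Z + 1.
Proof.
  intros Hk. pose proof (sumN_bump d k Z (fun x => x) Hk) as H. cbv beta in H.
  change (sumN d (bump Z k) = sumN d Z + (Z k + 1 - Z k)) in H. lra.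
Qed.

(** Here [z], [l] are the weights at the current vertex k, [s] is S and [t] is T. Multiplied by N_k,
    the first order drift of the potential from k has the k-dependent part D Z_k / T + L_k / Z_k - 2
    D L_k / T, which is [- s] times this quantity. Subtracting the corrector adds [s] times it and
    cancels that part. *)
Definition corrector (D z l s t : R) : R := (2 * D * l / t - D * z / t - l / z) / s.

Definition potential (d : nat) (b : R) (Z L : nat -> R) : R :=
  sumN d (fun j => ln (Z j) - b / Z j) - INR d * ln (sumN d Z + sumN d L).

Definition lyapunov (d : nat) (b : R) (k : nat) (Z L : nat -> R) : R :=
  potential d b Z L - corrector (INR d) (Z k) (L k) (sumN d Z) (sumN d Z + sumN d L).

(** The polynomial F multiplied out: T S times what remains of the first order drift, weighted by
    N_k, after the corrector has removed its dependence on k. *)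
Definition rate (d : nat) (Z L : nat -> R) : R :=
  INR d * sumN d Z * sumN d L + (sumN d L) ^ 2 - (sumN d Z) ^ 2
  + INR d * sumN d (fun j => (Z j) ^ 2) - 2 * INR d * sumN d (fun j => Z j * L j).

Lemma div_le_div a b c e : 0 < b -> 0 < e -> a * e <= c * b -> a / b <= c / e.
Proof.
  intros Hb He H. apply (Rmult_le_reg_r (b * e)); [nra|].
  replace (a / b * (b * e)) with (a * e) by (field; lra).
  replace (c / e * (b * e)) with (c * b) by (field; lra). auto.
Qed.

(** The corrector is subtracted, so only its increase matters. A jump raises [z], [s], [t] by one:
    the term D z / t costs at most 2 D / s, the term l / z at most 2 C0 / s, and the term 2 D l / t
    can only decrease. *)
Lemma corrector_jump D C0 z l s t : 0 <= D -> 1 <= z -> z <= s -> s <= t -> 0 <= l <= C0 * z ->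
  z * (corrector D (z + 1) l (s + 1) (t + 1) - corrector D z l s t) <= (2 * D + 2 * C0) / s.
Proof.
  intros HD Hz Hs Ht [Hl0 Hl]. unfold corrector.
  assert (Ha : z * z / (t * s) - z * (z + 1) / ((t + 1) * (s + 1)) <= 2 / s).
  { replace (z * z / (t * s) - z * (z + 1) / ((t + 1) * (s + 1))) with
      ((z * (z * (t + s + 1) - t * s)) / (t * s * ((t + 1) * (s + 1)))) by (field; lra).
    apply div_le_div; [|lra|].
    - repeat apply Rmult_lt_0_compat; lra.
    - assert (z * (z * (t + s + 1) - t * s) <= 2 * t * ((t + 1) * (s + 1))).
      { assert (z * z <= t * (s + 1)) by (apply Rmult_le_compat; lra).
        assert (z * z * (t + s + 1) <= t * (s + 1) * (2 * (t + 1))) by (apply Rmult_le_compat; nra).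
        assert (0 <= z * (t * s)) by (repeat apply Rmult_le_pos; lra). nra. }
      nra. }
  assert (Hb : l / ((t + 1) * (s + 1)) <= l / (t * s)).
  { apply div_le_div; nra. }
  assert (Hc : z * (l / (z * s) - l / ((z + 1) * (s + 1))) <= 2 * C0 / s).
  { replace (z * (l / (z * s) - l / ((z + 1) * (s + 1)))) with
      (l * (z + s + 1) / (s * ((z + 1) * (s + 1)))) by (field; lra).
    apply div_le_div; [|lra|].
    - repeat apply Rmult_lt_0_compat; lra.
    - assert (l * (z + s + 1) <= (C0 * z) * (2 * (s + 1))) by (apply Rmult_le_compat; lra).
      assert (0 <= C0) by nra.
      assert (C0 * z * (2 * (s + 1)) <= 2 * C0 * ((z + 1) * (s + 1))).
      { assert (0 <= C0 * (s + 1)) by nra. nra. }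
      nra. }
  replace ((2 * D + 2 * C0) / s) with (D * (2 / s) + 2 * C0 / s) by (field; lra).
  replace (z * ((2 * D * l / (t + 1) - D * (z + 1) / (t + 1) - l / (z + 1)) / (s + 1) -
    (2 * D * l / t - D * z / t - l / z) / s)) with
    (D * (z * z / (t * s) - z * (z + 1) / ((t + 1) * (s + 1)))
     + z * (2 * D) * (l / ((t + 1) * (s + 1)) - l / (t * s))
     + z * (l / (z * s) - l / ((z + 1) * (s + 1)))) by (field; lra).
  assert (D * (z * z / (t * s) - z * (z + 1) / ((t + 1) * (s + 1))) <= D * (2 / s))
    by (now apply Rmult_le_compat_l).
  assert (0 <= z * (2 * D)) by nra.
  assert (z * (2 * D) * (l / ((t + 1) * (s + 1)) - l / (t * s)) <= 0) by nra.
  lra.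
Qed.

(** A trip to a leaf raises [z], [l], [s] by one and [t] by two, the return being counted ahead. The
    terms cost 3 D / s, 2 D / s and 2 C0 ^ 2 / s; the square appears because the increment is now
    weighted by [l] instead of [z]. *)
Lemma corrector_loop D C0 z l s t : 0 <= D -> 0 <= C0 -> 1 <= z -> z <= s -> s <= t -> l <= t ->
  0 <= l <= C0 * z ->
  l * (corrector D (z + 1) (l + 1) (s + 1) (t + 2) - corrector D z l s t) <= (5 * D + 2 * C0 ^ 2) / s.
Proof.
  intros HD HC Hz Hs Ht Hlt [Hl0 Hl]. unfold corrector.
  assert (Ha : l * (z / (t * s) - (z + 1) / ((t + 2) * (s + 1))) <= 3 / s).
  { replace (l * (z / (t * s) - (z + 1) / ((t + 2) * (s + 1)))) with
      ((l * (z * (t + 2 * s + 2) - t * s)) / (t * s * ((t + 2) * (s + 1)))) by (field; lra).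
    apply div_le_div; [|lra|].
    - repeat apply Rmult_lt_0_compat; lra.
    - assert (l * (z * (t + 2 * s + 2) - t * s) <= 3 * t * ((t + 2) * (s + 1))).
      { assert (l * z <= t * (s + 1)) by (apply Rmult_le_compat; lra).
        assert (0 <= l * z) by nra.
        assert (l * z * (t + 2 * s + 2) <= t * (s + 1) * (3 * (t + 2))) by (apply Rmult_le_compat; lra).
        assert (0 <= l * (t * s)) by (repeat apply Rmult_le_pos; lra). nra. }
      nra. }
  assert (Hb : l * ((l + 1) / ((t + 2) * (s + 1)) - l / (t * s)) <= 1 / s).
  { assert (l / ((t + 2) * (s + 1)) <= l / (t * s)) by (apply div_le_div; nra).
    assert (l / ((t + 2) * (s + 1)) <= 1 / s) by (apply div_le_div; nra).
    replace (l * ((l + 1) / ((t + 2) * (s + 1)) - l / (t * s))) with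
      (l * (l / ((t + 2) * (s + 1)) - l / (t * s)) + l / ((t + 2) * (s + 1))) by (field; lra).
    nra. }
  assert (Hc : l * (l / (z * s) - (l + 1) / ((z + 1) * (s + 1))) <= 2 * C0 ^ 2 / s).
  { apply Rle_trans with (l * (l / (z * s) - l / ((z + 1) * (s + 1)))).
    - apply Rmult_le_compat_l; auto. apply Rplus_le_compat_l, Ropp_le_contravar.
      apply Rmult_le_compat_r; [|lra]. left; apply Rinv_0_lt_compat; nra.
    - replace (l * (l / (z * s) - l / ((z + 1) * (s + 1)))) with
        (l * l * (z + s + 1) / (z * s * ((z + 1) * (s + 1)))) by (field; lra).
      apply div_le_div; [|lra|].
      + repeat apply Rmult_lt_0_compat; lra.
      + assert (l * l <= (C0 * z) * (C0 * z)) by (apply Rmult_le_compat; lra).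
        assert (0 <= l * l) by nra.
        assert (l * l * (z + s + 1) <= (C0 * z) * (C0 * z) * (2 * (s + 1))) by (apply Rmult_le_compat; lra).
        assert (C0 * z * (C0 * z) * (2 * (s + 1)) <= 2 * C0 ^ 2 * (z * ((z + 1) * (s + 1)))).
        { assert (0 <= C0 * C0 * (z * (s + 1))) by (repeat apply Rmult_le_pos; lra). nra. }
        nra. }
  replace ((5 * D + 2 * C0 ^ 2) / s) with (D * (3 / s) + 2 * D * (1 / s) + 2 * C0 ^ 2 / s) by (field; lra).
  replace (l * ((2 * D * (l + 1) / (t + 2) - D * (z + 1) / (t + 2) - (l + 1) / (z + 1)) / (s + 1) -
    (2 * D * l / t - D * z / t - l / z) / s)) with
    (D * (l * (z / (t * s) - (z + 1) / ((t + 2) * (s + 1))))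
     + 2 * D * (l * ((l + 1) / ((t + 2) * (s + 1)) - l / (t * s)))
     + l * (l / (z * s) - (l + 1) / ((z + 1) * (s + 1)))) by (field; lra).
  assert (D * (l * (z / (t * s) - (z + 1) / ((t + 2) * (s + 1)))) <= D * (3 / s))
    by (now apply Rmult_le_compat_l).
  assert (2 * D * (l * ((l + 1) / ((t + 2) * (s + 1)) - l / (t * s))) <= 2 * D * (1 / s))
    by (apply Rmult_le_compat_l; lra).
  lra.
Qed.

(** * Increments of the potential and the one-step drift *)

Lemma ln_le_sub_1 x : 0 < x -> ln x <= x - 1.
Proof.
  intros Hx. replace x with (exp (ln x)) at 2 by (now apply exp_ln).
  pose proof (exp_ineq1_le (ln x)). lra.
Qed.

Lemma ln_shift_le t h : 0 < t -> 0 <= h -> ln (t + h) - ln t <= h / t.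
Proof.
  intros Ht Hh.
  assert (Hq : 0 < (t + h) / t) by (apply Rdiv_lt_0_compat; lra).
  pose proof (ln_le_sub_1 _ Hq) as H. replace (t + h) with (t * ((t + h) / t)) by (field; lra).
  rewrite ln_mult by lra. replace (h / t) with ((t + h) / t - 1) by (field; lra). lra.
Qed.

(* Replacing [ln z] by [ln z - b / z] turns the concavity loss of the logarithm
   into a gain of order [1 / z ^ 2], which absorbs every second order error. *)
Lemma ln_pole_incr b z : 0 < z ->
  1 / z + (b - 1) / (z * (z + 1)) <= (ln (z + 1) - b / (z + 1)) - (ln z - b / z).
Proof.
  intros Hz.
  assert (H : 1 / (z + 1) <= ln (z + 1) - ln z).
  { pose proof (ln_le_sub_1 (z / (z + 1))) as H.
    assert (Hq : 0 < z / (z + 1)) by (apply Rdiv_lt_0_compat; lra). specialize (H Hq).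
    unfold Rdiv in H at 1. rewrite ln_mult, ln_Rinv in H by (try apply Rinv_0_lt_compat; lra).
    replace (1 / (z + 1)) with (1 - z / (z + 1)) by (field; lra). lra. }
  replace (1 / z + (b - 1) / (z * (z + 1))) with (1 / (z + 1) + b / z - b / (z + 1)) by (field; lra).
  lra.
Qed.

(* [C0] bounds the ratios [L j / Z j]; [C1] is the slack that makes the drift nonnegative. *)
Definition pole_weight (d : nat) (C0 C1 : R) : R :=
  1 + 2 * (2 * INR d + 2 * C0 + (5 * INR d + 2 * C0 ^ 2 + C1)).

Section Drift.

Context (d k : nat) (C0 C1 : R) (Z L : nat -> R).

Let D := INR d.
Let E := 5 * D + 2 * C0 ^ 2 + C1.
Let b := pole_weight d C0 C1.
Let S := sumN d Z.
Let T := sumN d Z + sumN d L.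

Context (Hd : (2 <= d)%nat).
Context (Hk : (k < d)%nat).
Context (HC0 : 0 <= C0).
Context (HC1 : 0 <= C1).
Context (HZ : forall j, (j < d)%nat -> 1 <= Z j).
Context (HL : forall j, (j < d)%nat -> 0 <= L j <= C0 * Z j).

Lemma Z_le_S j : (j < d)%nat -> Z j <= S.
Proof. intros Hj. apply sumN_term_le; auto. intros i Hi. specialize (HZ i Hi); lra. Qed.

Lemma L_le_T j : (j < d)%nat -> L j <= T.
Proof.
  intros Hj. assert (L j <= sumN d L) by (apply sumN_term_le; auto; intros i Hi; apply HL; auto).
  assert (0 <= sumN d Z) by (apply sumN_nonneg; intros i Hi; specialize (HZ i Hi); lra).
  unfold T; lra.
Qed.

Lemma S_le_T : S <= T.
Proof.
  assert (0 <= sumN d L) by (apply sumN_nonneg; intros i Hi; apply HL; auto). unfold S, T; lra.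
Qed.

(** After paying for the corrector, the pole still leaves the surplus [E / S] on every jump; it is
    reserved for the loop error and for [C1]. *)
Lemma jump_gain j : (j < d)%nat ->
  Z j * potential d b Z L + 1 - D * Z j / T - Z j * corrector D (Z j) (L j) S T + E / S
  <= Z j * lyapunov d b j (bump Z j) L.
Proof.
  intros Hj. pose proof (HZ j Hj) as Hz. pose proof (Z_le_S j Hj) as Hs. pose proof S_le_T as Hst.
  pose proof (HL j Hj) as Hl.
  assert (HD : 0 <= D) by apply pos_INR.
  pose proof (corrector_jump D C0 (Z j) (L j) S T HD Hz Hs Hst Hl) as Hc.
  unfold lyapunov, potential. rewrite bump_eq.
  rewrite (sumN_bump_id d j Z) by auto.
  rewrite (sumN_bump d j Z (fun x => ln x - b / x)) by auto.
  pose proof (ln_pole_incr b (Z j)) as Hp. specialize (Hp ltac:(lra)).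
  pose proof (ln_shift_le T 1 ltac:(lra) ltac:(lra)) as Ht.
  replace (sumN d Z + 1 + sumN d L) with (T + 1) by (unfold S, T; ring).
  fold S T D. set (P := sumN d (fun j0 => ln (Z j0) - b / Z j0)) in *.
  set (g' := corrector D (Z j + 1) (L j) (S + 1) (T + 1)) in *.
  set (g := corrector D (Z j) (L j) S T) in *.
  set (a := ln (Z j + 1) - b / (Z j + 1)) in *. set (a0 := ln (Z j) - b / Z j) in *.
  assert (H1 : 1 + (b - 1) / (Z j + 1) <= Z j * (a - a0)).
  { replace (1 + (b - 1) / (Z j + 1)) with (Z j * (1 / Z j + (b - 1) / (Z j * (Z j + 1)))) by (field; lra).
    apply Rmult_le_compat_l; lra. }
  (* [Z j + 1 <= 2 * S] is the origin of the factor 2 in [pole_weight]. *)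
  assert (H2 : (b - 1) / (2 * S) <= (b - 1) / (Z j + 1)).
  { apply Rmult_le_compat_l; [|apply Rinv_le_contravar; lra].
    assert (0 <= C0 ^ 2) by (apply pow2_ge_0). unfold b, pole_weight. fold D. lra. }
  assert (H3 : (b - 1) / (2 * S) = (2 * D + 2 * C0) / S + E / S).
  { unfold b, pole_weight, E. fold D. field; lra. }
  assert (H4 : Z j * (D * (ln (T + 1) - ln T)) <= D * Z j / T).
  { replace (D * Z j / T) with (Z j * (D * (1 / T))) by (field; lra).
    apply Rmult_le_compat_l; [lra|]. now apply Rmult_le_compat_l. }
  change (S + sumN d L) with T. clearbody g g' a a0 P S T E b. nra.
Qed.

(** The gain from the pole carries the factor [L k], which may be 0, so it is discarded here. The
    corrector error remains as a loss, to be covered by the jumps. *)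
Lemma loop_gain :
  L k * potential d b Z L + L k / Z k - 2 * D * L k / T - L k * corrector D (Z k) (L k) S T
    - (5 * D + 2 * C0 ^ 2) / S
  <= L k * lyapunov d b k (bump Z k) (bump L k).
Proof.
  pose proof (HZ k Hk) as Hz. pose proof (Z_le_S k Hk) as Hs. pose proof S_le_T as Hst.
  pose proof (HL k Hk) as Hl. pose proof (L_le_T k Hk) as Hlt.
  assert (HD : 0 <= D) by apply pos_INR.
  pose proof (corrector_loop D C0 (Z k) (L k) S T HD HC0 Hz Hs Hst Hlt Hl) as Hc.
  unfold lyapunov, potential. rewrite !bump_eq.
  rewrite (sumN_bump_id d k Z), (sumN_bump_id d k L) by auto.
  rewrite (sumN_bump d k Z (fun x => ln x - b / x)) by auto.
  pose proof (ln_pole_incr b (Z k)) as Hp. specialize (Hp ltac:(lra)).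
  pose proof (ln_shift_le T 2 ltac:(lra) ltac:(lra)) as Ht.
  replace (sumN d Z + 1 + (sumN d L + 1)) with (T + 2) by (unfold S, T; ring).
  fold S T D. set (P := sumN d (fun j0 => ln (Z j0) - b / Z j0)) in *.
  set (g' := corrector D (Z k + 1) (L k + 1) (S + 1) (T + 2)) in *.
  set (g := corrector D (Z k) (L k) S T) in *.
  set (a := ln (Z k + 1) - b / (Z k + 1)) in *. set (a0 := ln (Z k) - b / Z k) in *.
  assert (Hb : 0 <= (b - 1) / (Z k * (Z k + 1))).
  { apply Rmult_le_pos; [|left; apply Rinv_0_lt_compat; nra].
    assert (0 <= C0 ^ 2) by (apply pow2_ge_0). unfold b, pole_weight. fold D. lra. }
  assert (H1 : L k / Z k <= L k * (a - a0)).
  { replace (L k / Z k) with (L k * (1 / Z k)) by (field; lra).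
    apply Rmult_le_compat_l; lra. }
  assert (H4 : L k * (D * (ln (T + 2) - ln T)) <= 2 * D * L k / T).
  { replace (2 * D * L k / T) with (L k * (D * (2 / T))) by (field; lra).
    apply Rmult_le_compat_l; [lra|]. now apply Rmult_le_compat_l. }
  change (S + sumN d L) with T. clearbody g g' a a0 P S T E b. nra.
Qed.

(** With N_k = [S - Z k + L k] multiplied out, jumps and loop add up linearly, the terms depending
    on [k] cancel against the corrector, and [rate / (T * S)] is left. *)
Lemma lyapunov_drift :
  (rate d Z L + C1 * T) / (T * S) + (S - Z k + L k) * lyapunov d b k Z L
  <= sumN d (fun j => if Nat.eqb j k then 0 else Z j * lyapunov d b j (bump Z j) L)
     + L k * lyapunov d b k (bump Z k) (bump L k).
Proof.
  pose proof (HZ k Hk) as Hz. pose proof (Z_le_S k Hk) as Hs. pose proof S_le_T as Hst.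
  assert (HD : 2 <= D) by (change 2 with (INR 2); apply le_INR; auto).
  apply Rle_trans with (2 := Rplus_le_compat_l _ _ _ loop_gain).
  set (gain := fun j => Z j * potential d b Z L + 1 - D * Z j / T
    - Z j * corrector D (Z j) (L j) S T + E / S).
  apply Rle_trans with (sumN d (fun j => if Nat.eqb j k then 0 else gain j)
    + (L k * potential d b Z L + L k / Z k - 2 * D * L k / T - L k * corrector D (Z k) (L k) S T
    - (5 * D + 2 * C0 ^ 2) / S)).
  2:{ apply Rplus_le_compat_r, sumN_le. intros j Hj. destruct Nat.eqb; [lra|]. now apply jump_gain. }
  rewrite sumN_except by auto.
  assert (HG : sumN d gain = S * potential d b Z L + D - D * S / T
     - (2 * D * sumN d (fun j => Z j * L j) / T - D * sumN d (fun j => Z j ^ 2) / T - sumN d L) / S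
     + D * (E / S)).
  { rewrite (sumN_ext d gain (fun j => (potential d b Z L - D / T) * Z j + ((1 + E / S) +
      ((- (2 * D / T / S)) * (Z j * L j) + ((D / T / S) * Z j ^ 2 + (/ S) * L j))))).
    - rewrite !sumN_plus, !sumN_scal, !sumN_const. fold S D. field. lra.
    - intros j Hj. specialize (HZ j Hj). unfold gain, corrector. field. lra. }
  rewrite HG. unfold gain, lyapunov. fold S T D.
  set (P := potential d b Z L). unfold corrector, rate. fold S D.
  set (ZL := sumN d (fun j => Z j * L j)). set (ZZ := sumN d (fun j => Z j ^ 2)).
  replace (sumN d L) with (T - S) by (unfold T, S; ring).
  assert (HE : 0 <= E / S - (5 * D + 2 * C0 ^ 2) / S - C1 / S).
  { unfold E. right. field. lra. }
  assert (HE2 : 0 <= (D - 2) * (E / S)).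
  { apply Rmult_le_pos; [lra|]. apply Rmult_le_pos; [|left; apply Rinv_0_lt_compat; lra].
    assert (0 <= C0 ^ 2) by apply pow2_ge_0. unfold E; lra. }
  (* Of the D - 1 surpluses [E / S], one pays exactly for the loop error and for the slack [C1 / S];
     the other D - 2 are left over. *)
  match goal with |- ?l <= ?r => enough (Hlr : r - l = (D - 2) * (E / S) + (E / S - (5 * D + 2 * C0 ^ 2) / S - C1 / S)) by lra end.
  field. lra.
Qed.

End Drift.

Lemma Rabs_le_inv x a : Rabs x <= a -> - a <= x <= a.
Proof. unfold Rabs; destruct Rcase_abs; lra. Qed.

Lemma sumN_variance d y : (0 < d)%nat ->
  INR d * sumN d (fun j => (y j - sumN d y / INR d) ^ 2)
  = INR d * sumN d (fun j => y j ^ 2) - sumN d y ^ 2.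
Proof.
  intros Hd. assert (HD : 0 < INR d) by now apply lt_0_INR.
  set (m := sumN d y / INR d).
  rewrite (sumN_ext d _ (fun j => y j ^ 2 + (- (2 * m) * y j + m ^ 2))) by (intros; ring).
  rewrite !sumN_plus, sumN_scal, sumN_const.
  change (sumN d (fun j => y j)) with (sumN d y). unfold m. field. lra.
Qed.

(** * Sign of the rate and entropy of a single configuration *)

Section Potential.

Context (d : nat) (Z L l0 : nat -> R).

Let D := INR d.
Let S := sumN d Z.
Let Lt := sumN d L.
Let T := S + Lt.
Let l := sumN d l0.

Context (Hd : (3 <= d)%nat).
Context (HZ : forall j, (j < d)%nat -> 1 <= Z j).
Context (Hl0 : forall j, (j < d)%nat -> 0 <= l0 j).
Context (HL : forall j, (j < d)%nat -> 0 <= L j <= Z j + l0 j).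

(** Since [Z j >= 1], the additive excess [l0 j <= l] is at most [l * Z j]. This gives the ratio
    bound [C0 = 1 + l]. *)
Lemma L_le_scaled_Z j : (j < d)%nat -> 0 <= L j <= (1 + l) * Z j.
Proof.
  intros Hj. pose proof (HZ j Hj). pose proof (HL j Hj).
  assert (0 <= l0 j <= l) by (split; auto; now apply sumN_term_le). nra.
Qed.

(** The variance identity for [Z j - L j], whose sum is [S - Lt], absorbs the negative square. Only
    the last of the three terms can be negative. *)
Lemma rate_decomposition :
  rate d Z L = D * sumN d (fun j => (Z j - L j - (S - Lt) / D) ^ 2)
    + D * sumN d (fun j => L j * (Lt - L j)) + (D - 2) * Lt * (S - Lt).
Proof.
  pose proof (sumN_variance d (fun j => Z j - L j) ltac:(lia)) as E. cbv beta in E.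
  assert (E1 : sumN d (fun j => Z j - L j) = S - Lt).
  { rewrite (sumN_ext d _ (fun j => Z j + (-1) * L j)) by (intros; ring).
    rewrite sumN_plus, sumN_scal. change (S + -1 * Lt = S - Lt). ring. }
  rewrite E1 in E. fold D in E. rewrite E.
  rewrite (sumN_ext d (fun j => L j * (Lt - L j)) (fun j => Lt * L j + (-1) * L j ^ 2)) by (intros; ring).
  rewrite (sumN_ext d (fun j => (Z j - L j) ^ 2) (fun j => Z j ^ 2 + ((-2) * (Z j * L j) + L j ^ 2)))
    by (intros; ring).
  rewrite !sumN_plus, !sumN_scal. change (sumN d (fun j => L j)) with Lt.
  unfold rate. fold D S Lt. ring.
Qed.

Lemma D_ge_3 : 3 <= D.
Proof. apply le_INR in Hd. simpl in Hd. unfold D. lra. Qed.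

Lemma Lt_nonneg : 0 <= Lt.
Proof. apply sumN_nonneg. intros j Hj. apply HL; auto. Qed.

Lemma S_Lt_ge : - l <= S - Lt.
Proof.
  assert (H : Lt <= sumN d (fun j => Z j + l0 j)) by (apply sumN_le; intros j Hj; now apply HL).
  rewrite sumN_plus in H. change (Lt <= S + l) in H. lra.
Qed.

Lemma l_nonneg : 0 <= l.
Proof. now apply sumN_nonneg. Qed.

Lemma T_pos : 1 <= T /\ S <= T /\ Lt <= T.
Proof.
  pose proof Lt_nonneg. assert (Z 0%nat <= S).
  { apply sumN_term_le; [lia|]. intros j Hj; specialize (HZ j Hj); lra. }
  pose proof (HZ 0%nat ltac:(lia)). unfold T; lra.
Qed.

(** In the last term, [Lt <= T] and [S - Lt >= - l] limit the loss to [D * l * T], which fixes the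
    slack [C1 = D * l]. *)
Lemma rate_terms_nonneg :
  0 <= D * sumN d (fun j => (Z j - L j - (S - Lt) / D) ^ 2) /\
  0 <= D * sumN d (fun j => L j * (Lt - L j)) /\
  0 <= (D - 2) * Lt * (S - Lt) + D * l * T.
Proof.
  pose proof D_ge_3 as HD. pose proof Lt_nonneg as HLt. pose proof S_Lt_ge as HS.
  pose proof l_nonneg as Hl. destruct T_pos as (HT & HST & HLT).
  split; [|split].
  - apply Rmult_le_pos; [lra|]. apply sumN_nonneg. intros; apply pow2_ge_0.
  - apply Rmult_le_pos; [lra|]. apply sumN_nonneg. intros j Hj.
    apply Rmult_le_pos; [now apply HL|]. enough (L j <= Lt) by lra.
    apply sumN_term_le; auto. intros i Hi; now apply HL.
  - assert (0 <= (D - 2) * Lt) by (apply Rmult_le_pos; lra).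
    assert ((D - 2) * Lt * - l <= (D - 2) * Lt * (S - Lt)) by (now apply Rmult_le_compat_l).
    assert ((D - 2) * Lt <= D * T) by (apply Rmult_le_compat; lra).
    assert ((D - 2) * Lt * l <= D * T * l) by (now apply Rmult_le_compat_r). nra.
Qed.

Lemma rate_nonneg : 0 <= rate d Z L + D * l * T.
Proof. rewrite rate_decomposition. pose proof rate_terms_nonneg. lra. Qed.

(** The last term controls [Lt] once [S - Lt] is of order [T]. If some [Z i - L i] exceeds c T / 2,
    then S - Lt >= c T / 4 and Lt <= 4 eps^2 T / c <= 2 eps T. Otherwise every [L j] is at least c T
    / 2 >= eps T, and the product [L 0 * L 1] alone makes the rate too large. *)
Lemma leaves_small c eps : 0 < eps -> 2 * eps <= c ->
  (forall j, (j < d)%nat -> c * T <= Z j) -> 4 * l <= c * T ->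
  rate d Z L + D * l * T <= eps ^ 2 * T ^ 2 -> Lt <= 2 * eps * T.
Proof.
  intros He Hc HcZ HT4 Hr. rewrite rate_decomposition in Hr.
  destruct rate_terms_nonneg as (H1 & H2 & H3). pose proof D_ge_3 as HD.
  destruct T_pos as (HT & HST & HLT). pose proof Lt_nonneg as HLt. pose proof l_nonneg as Hl.
  destruct (classic (exists i, (i < d)%nat /\ c * T / 2 < Z i - L i)) as [(i & Hi & Hy)|Hn].
  - assert (Hgap : c * T / 2 - l <= S - Lt).
    { assert (E : sumN d (fun j => Z j - L j + l0 j) = S - Lt + l).
      { rewrite (sumN_ext d _ (fun j => Z j + ((-1) * L j + l0 j))) by (intros; ring).
        rewrite !sumN_plus, sumN_scal. change (S + (-1 * Lt + l) = S - Lt + l). ring. }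
      assert (Z i - L i + l0 i <= S - Lt + l).
      { rewrite <- E. apply (sumN_term_le d i (fun j => Z j - L j + l0 j)); auto.
        intros j Hj. pose proof (HL j Hj). lra. }
      pose proof (Hl0 i Hi). lra. }
    assert (HcT : 0 < c * T) by (apply Rmult_lt_0_compat; lra).
    assert (Hgap' : c * T / 4 <= S - Lt) by lra.
    assert (Hp : Lt * (c * T / 4) <= (D - 2) * Lt * (S - Lt)).
    { apply Rle_trans with (Lt * (S - Lt)); [now apply Rmult_le_compat_l|].
      assert (0 <= Lt * (S - Lt)) by (apply Rmult_le_pos; lra). nra. }
    assert (0 <= D * l * T) by (repeat apply Rmult_le_pos; lra).
    assert (Hq : Lt * c * T <= 4 * eps ^ 2 * T * T) by nra.
    apply Rmult_le_reg_r in Hq; [|lra].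
    apply (Rmult_le_reg_r c); [lra|].
    assert (0 < eps * T) by (apply Rmult_lt_0_compat; lra). nra.
  - exfalso. assert (Hhalf : forall j, (j < d)%nat -> c * T / 2 <= L j).
    { intros j Hj. destruct (Rle_or_lt (c * T / 2) (L j)) as [|Hlt]; auto. destruct Hn.
      exists j. split; auto. pose proof (HcZ j Hj). lra. }
    assert (H01 : L 0%nat * L 1%nat <= sumN d (fun j => L j * (Lt - L j))).
    { apply Rle_trans with (L 0%nat * (Lt - L 0%nat)).
      - apply Rmult_le_compat_l; [apply HL; lia|].
        pose proof (sumN_except d 0 L ltac:(lia)) as E. fold Lt in E. rewrite <- E.
        apply (sumN_term_le d 1 (fun j => if Nat.eqb j 0 then 0 else L j)); [lia|].
        intros j Hj. destruct Nat.eqb; [lra|now apply HL].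
      - apply (sumN_term_le d 0 (fun j => L j * (Lt - L j))); [lia|].
        intros j Hj. apply Rmult_le_pos; [now apply HL|]. enough (L j <= Lt) by lra.
        apply sumN_term_le; auto. intros i Hi; now apply HL. }
    pose proof (Hhalf 0%nat ltac:(lia)) as Ha. pose proof (Hhalf 1%nat ltac:(lia)) as Hb.
    assert (Hc2 : eps * T <= c * T / 2) by nra.
    assert (0 < eps * T) by nra.
    assert (Hm : (eps * T) * (eps * T) <= L 0%nat * L 1%nat) by (apply Rmult_le_compat; lra).
    nra.
Qed.

(** The variance term bounds [y j] by eps T. The remainder of [Z j - T / D] is [L j - 2 * (Lt / D)],
    at most 2 Lt <= 4 eps T in absolute value; together 5 eps T. *)
Lemma near_uniform c eps j : 0 < eps -> 2 * eps <= c ->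
  (forall j, (j < d)%nat -> c * T <= Z j) -> 4 * l <= c * T ->
  rate d Z L + D * l * T <= eps ^ 2 * T ^ 2 -> (j < d)%nat ->
  Rabs (Z j - T / D) <= 5 * eps * T.
Proof.
  intros He Hc HcZ HT4 Hr Hj. pose proof (leaves_small c eps He Hc HcZ HT4 Hr) as Hsm.
  rewrite rate_decomposition in Hr.
  destruct rate_terms_nonneg as (H1 & H2 & H3). pose proof D_ge_3 as HD.
  destruct T_pos as (HT & HST & HLT).
  set (y := fun j => Z j - L j - (S - Lt) / D) in *.
  assert (Hy : y j ^ 2 <= sumN d (fun j => y j ^ 2)).
  { apply (sumN_term_le d j (fun j => y j ^ 2)); auto. intros; apply pow2_ge_0. }
  assert (Hy2 : y j ^ 2 <= (eps * T) ^ 2) by (pose proof (pow2_ge_0 (y j)); unfold y in *; nra).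
  assert (Hy3 : Rabs (y j) <= eps * T).
  { rewrite <- (Rabs_pos_eq (eps * T)) by nra. apply Rsqr_le_abs_0. unfold Rsqr. nra. }
  assert (HLj : 0 <= L j <= Lt).
  { split; [now apply HL|]. apply sumN_term_le; auto. intros i Hi; now apply HL. }
  assert (E : Z j - T / D = y j + (L j - 2 * (Lt / D))) by (unfold y, T; field; lra).
  assert (HLD : 0 <= Lt / D <= Lt).
  { split; [apply Rmult_le_pos; [lra|left; apply Rinv_0_lt_compat; lra]|].
    apply (Rmult_le_reg_r D); [lra|]. unfold Rdiv. rewrite Rmult_assoc, Rinv_l by lra. nra. }
  rewrite E. apply Rabs_le. apply Rabs_le_inv in Hy3. lra.
Qed.

Lemma corrector_abs_le k : (k < d)%nat ->
  Rabs (corrector D (Z k) (L k) S T) <= (3 * D + 1 + l) / S.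
Proof.
  intros Hk. pose proof (HZ k Hk) as Hz. pose proof (L_le_scaled_Z k Hk) as Hl.
  destruct T_pos as (HT & HST & HLT). pose proof D_ge_3 as HD.
  assert (HzS : Z k <= S) by (apply sumN_term_le; auto; intros i Hi; specialize (HZ i Hi); lra).
  assert (HlT : L k <= Lt) by (apply sumN_term_le; auto; intros i Hi; now apply HL).
  assert (Hq : forall a, 0 <= a <= T -> 0 <= a / T <= 1).
  { intros a Ha. split; [apply Rmult_le_pos; [lra|left; apply Rinv_0_lt_compat; lra]|].
    apply (Rmult_le_reg_r T); [lra|]. unfold Rdiv. rewrite Rmult_assoc, Rinv_l by lra. lra. }
  pose proof (Hq (L k) ltac:(lra)) as H1. pose proof (Hq (Z k) ltac:(lra)) as H2.
  assert (H3 : 0 <= L k / Z k <= 1 + l).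
  { split; [apply Rmult_le_pos; [lra|left; apply Rinv_0_lt_compat; lra]|].
    apply (Rmult_le_reg_r (Z k)); [lra|]. unfold Rdiv. rewrite Rmult_assoc, Rinv_l by lra. lra. }
  unfold corrector. unfold Rdiv at 1. rewrite Rabs_mult.
  rewrite (Rabs_pos_eq (/ S)) by (left; apply Rinv_0_lt_compat; lra).
  apply Rmult_le_compat_r; [left; apply Rinv_0_lt_compat; lra|].
  replace (2 * D * L k / T) with (2 * D * (L k / T)) by (unfold Rdiv; ring).
  replace (D * Z k / T) with (D * (Z k / T)) by (unfold Rdiv; ring).
  apply Rabs_le. nra.
Qed.

(** Normalised so that the uniform configuration without leaf weight has all shares 1 and entropy 0,
    the maximum. *)
Let share j := D * (Z j / T).
Let entropy := sumN d (fun j => ln (share j)).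

Lemma share_pos j : (j < d)%nat -> 0 < share j.
Proof.
  intros Hj. pose proof (HZ j Hj). destruct T_pos as (HT & HST & HLT). pose proof D_ge_3.
  apply Rmult_lt_0_compat; [lra|]. apply Rdiv_lt_0_compat; lra.
Qed.

Lemma potential_entropy b :
  potential d b Z L = entropy - D * ln D - b * sumN d (fun j => / Z j).
Proof.
  destruct T_pos as (HT & HST & HLT). pose proof D_ge_3 as HD.
  unfold entropy. rewrite (sumN_ext d (fun j => ln (share j)) (fun j => ln (Z j) + (ln D - ln T))).
  - unfold potential. rewrite (sumN_ext d _ (fun j => ln (Z j) + (- b) * / Z j)) by (intros; unfold Rdiv; ring).
    rewrite !sumN_plus, sumN_scal, sumN_const. fold D S Lt T. ring.
  - intros j Hj. pose proof (HZ j Hj). unfold share, Rdiv.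
    rewrite !ln_mult, ln_Rinv; try lra; try (apply Rinv_0_lt_compat; lra).
    apply Rmult_lt_0_compat; [lra|]. apply Rinv_0_lt_compat; lra.
Qed.

Lemma sum_share_le : sumN d share <= D.
Proof.
  destruct T_pos as (HT & HST & HLT). pose proof D_ge_3 as HD.
  unfold share. rewrite (sumN_ext d _ (fun j => (D / T) * Z j)) by (intros; unfold Rdiv; ring).
  rewrite sumN_scal. change (sumN d (fun j => Z j)) with S.
  replace D with (D / T * T) at 2 by (field; lra).
  apply Rmult_le_compat_l; auto. apply Rmult_le_pos; [lra|]. left; apply Rinv_0_lt_compat; lra.
Qed.

(* [ln x = 2 ln (sqrt x) <= 2 (sqrt x - 1)], so each term falls short of
   [x - 1] by at least [(sqrt x - 1) ^ 2]; the shares sum to at most [D]. *)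
Lemma entropy_deficit j : (j < d)%nat -> (sqrt (share j) - 1) ^ 2 <= - entropy.
Proof.
  intros Hj.
  assert (H : sumN d (fun i => ln (share i) + (sqrt (share i) - 1) ^ 2) <= sumN d (fun i => share i + (-1))).
  { apply sumN_le. intros i Hi. pose proof (share_pos i Hi) as Hp.
    pose proof (sqrt_lt_R0 _ Hp) as Hs. pose proof (sqrt_sqrt (share i) ltac:(lra)) as Hss.
    pose proof (ln_le_sub_1 _ Hs) as Hln. rewrite <- Hss at 1. rewrite ln_mult by auto. nra. }
  rewrite !sumN_plus, sumN_const in H. fold entropy D in H.
  change (sumN d (fun i => share i)) with (sumN d share) in H.
  pose proof sum_share_le.
  assert ((sqrt (share j) - 1) ^ 2 <= sumN d (fun i => (sqrt (share i) - 1) ^ 2)).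
  { apply (sumN_term_le d j (fun i => (sqrt (share i) - 1) ^ 2)); auto. intros; apply pow2_ge_0. }
  lra.
Qed.

(** The entropy is at most 0, the pole terms only lower the value, and the corrector is at most 3 D
    + 1 + l because S >= 1. The complement to this bound is the nonnegative process used for
    betting. *)
Lemma lyapunov_le b k : 0 <= b -> (k < d)%nat ->
  lyapunov d b k Z L <= 3 * D + 1 + l - D * ln D.
Proof.
  intros Hb Hk. unfold lyapunov. rewrite potential_entropy. fold D S Lt T.
  pose proof (corrector_abs_le k Hk) as Hc. apply Rabs_le_inv in Hc.
  pose proof (entropy_deficit k Hk). pose proof (pow2_ge_0 (sqrt (share k) - 1)).
  pose proof D_ge_3. pose proof l_nonneg.
  assert (0 <= b * sumN d (fun j => / Z j)).
  { apply Rmult_le_pos; auto. apply sumN_nonneg. intros i Hi. specialize (HZ i Hi).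
    left; apply Rinv_0_lt_compat; lra. }
  assert (HS : 1 <= S).
  { apply Rle_trans with (Z k); auto. apply sumN_term_le; auto. intros i Hi; specialize (HZ i Hi); lra. }
  assert ((3 * D + 1 + l) / S <= 3 * D + 1 + l).
  { apply (Rmult_le_reg_r S); [lra|]. unfold Rdiv. rewrite Rmult_assoc, Rinv_l by lra. nra. }
  lra.
Qed.

(** For each share x, ln x >= - (1 - x) / x, with 1 - x <= 5 D eps from [near_uniform] and x >= D c
    from proportionality. *)
Lemma entropy_near_uniform c eps : 0 < eps -> 2 * eps <= c ->
  (forall j, (j < d)%nat -> c * T <= Z j) -> 4 * l <= c * T ->
  rate d Z L + D * l * T <= eps ^ 2 * T ^ 2 -> - (5 * D * eps / c) <= entropy.
Proof.
  intros He Hc HcZ HT4 Hr. destruct T_pos as (HT & HST & HLT). pose proof D_ge_3 as HD.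
  replace (- (5 * D * eps / c)) with (sumN d (fun _ => - (5 * eps / c))) by
    (rewrite sumN_const; fold D; field; lra).
  apply sumN_le. intros j Hj. pose proof (near_uniform c eps j He Hc HcZ HT4 Hr Hj) as Hn.
  pose proof (share_pos j Hj) as Hp. set (x := share j) in *.
  assert (Hinv : 0 < / x) by now apply Rinv_0_lt_compat.
  pose proof (ln_le_sub_1 _ Hinv) as Hln. rewrite ln_Rinv in Hln by auto.
  enough (/ x - 1 <= 5 * eps / c) by lra.
  apply (Rmult_le_reg_r (x * c)); [nra|].
  replace ((/ x - 1) * (x * c)) with ((1 - x) * c) by (field; lra).
  replace (5 * eps / c * (x * c)) with (5 * eps * x) by (field; lra).
  assert (Hx : D * c <= x).
  { unfold x, share. apply Rmult_le_compat_l; [lra|]. apply (Rmult_le_reg_r T); [lra|].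
    unfold Rdiv. rewrite Rmult_assoc, Rinv_l by lra. pose proof (HcZ j Hj). lra. }
  assert (Hx1 : 1 - x <= 5 * D * eps).
  { apply Rabs_le_inv in Hn. apply (Rmult_le_reg_r (T / D)); [apply Rdiv_lt_0_compat; lra|].
    unfold x, share. replace ((1 - D * (Z j / T)) * (T / D)) with (T / D - Z j) by (field; lra).
    replace (5 * D * eps * (T / D)) with (5 * eps * T) by (field; lra). lra. }
  nra.
Qed.

End Potential.

(** * Deterministic analysis of a path *)

Lemma ln_le x y : 0 < x -> x <= y -> ln x <= ln y.
Proof. intros Hx [H|<-]; [left; now apply ln_increasing|apply Rle_refl]. Qed.

Section PathLimit.

(** Data of one path: [tau] is the total initial weight, and [T n] may exceed [tau + n] by the one
    visit counted ahead; [inner] marks the times spent at interior vertices; [G] is the accumulated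
    drift. *)
Context (d : nat) (b tau q B : R) (Z L : nat -> nat -> R) (l0 : nat -> R)
  (pos : nat -> nat) (inner : nat -> bool) (G : nat -> R).

Let D := INR d.
Let l := sumN d l0.
Let S n := sumN d (Z n).
Let T n := sumN d (Z n) + sumN d (L n).
Let share n j := D * (Z n j / T n).
Let entropy n := sumN d (fun j => ln (share n j)).
Let Q n := 3 * D + 1 + l - D * ln D - lyapunov d b (pos n) (Z n) (L n).

Context (Hd : (3 <= d)%nat).
Context (Hb : 0 <= b).
Context (HZ : forall n j, (j < d)%nat -> 1 <= Z n j).
Context (Hl0 : forall j, (j < d)%nat -> 0 <= l0 j).
Context (HL : forall n j, (j < d)%nat -> 0 <= L n j <= Z n j + l0 j).
Context (Hpos : forall n, (pos n < d)%nat).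
Context (Htau : 0 <= tau).
Context (HT : forall n, tau + INR n <= T n <= tau + INR n + 1).
Context (Hinner : forall n, inner n = true \/ inner (Datatypes.S n) = true).
Context (HQ : Un_cv Q q).
Context (HG : forall n, G (Datatypes.S n) = G n +
  if inner n then (rate d (Z n) (L n) + D * l * T n) / (T n * S n) / (S n - Z n (pos n) + L n (pos n)) else 0).
Context (HGB : forall n, 0 <= G n <= B).

Lemma path_D_ge_3 : 3 <= D.
Proof. exact (D_ge_3 d Hd). Qed.

Lemma path_T n : 1 <= T n /\ S n <= T n /\ sumN d (L n) <= T n.
Proof. exact (T_pos d (Z n) (L n) l0 Hd (HZ n) (HL n)). Qed.

Lemma Q_entropy n : Q n = 3 * D + 1 + l - entropy n + b * sumN d (fun j => / Z n j)
  + corrector D (Z n (pos n)) (L n (pos n)) (S n) (T n).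
Proof.
  unfold Q, lyapunov. rewrite (potential_entropy d (Z n) (L n) l0 Hd (HZ n) (HL n)).
  unfold entropy, share, S, T. fold D. ring.
Qed.

(** A bound [M] on the convergent [Q] gives entropy >= - M. Every share is at most D, so the other
    logarithms total at most D ln D and none can fall below - (M + D ln D). *)
Lemma path_proportional : exists c, 0 < c /\ forall n j, (j < d)%nat -> c * T n <= Z n j.
Proof.
  pose proof path_D_ge_3 as HD.
  destruct (maj_by_pos Q (exist _ q HQ)) as (M & HM & HQM).
  set (K := M + D * ln D). exists (exp (- K) / D).
  assert (HlnD : 0 <= ln D) by (rewrite <- ln_1; apply ln_le; lra).
  pose proof (exp_pos (- K)) as Hexp.
  split; [apply Rdiv_lt_0_compat; lra|]. intros n j Hj.
  destruct (path_T n) as (HT1 & HST & _).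
  assert (Hsh : forall i, (i < d)%nat -> 0 < share n i <= D).
  { intros i Hi. pose proof (HZ n i Hi).
    assert (Z n i <= S n) by (apply sumN_term_le; auto; intros m Hm; specialize (HZ n m Hm); lra).
    split.
    - exact (share_pos d (Z n) (L n) l0 Hd (HZ n) (HL n) i Hi).
    - unfold share. rewrite <- (Rmult_1_r D) at 2. apply Rmult_le_compat_l; [lra|].
      apply (Rmult_le_reg_r (T n)); [lra|]. unfold Rdiv. rewrite Rmult_assoc, Rinv_l; lra. }
  assert (Hent : - M <= entropy n).
  { pose proof (HQM n) as HQn. apply Rabs_le_inv in HQn. rewrite Q_entropy in HQn.
    pose proof (corrector_abs_le d (Z n) (L n) l0 Hd (HZ n) Hl0 (HL n) (pos n) (Hpos n)) as Hc.
    apply Rabs_le_inv in Hc. fold D l (S n) in Hc. change (S n + sumN d (L n)) with (T n) in Hc.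
    assert (0 <= b * sumN d (fun j => / Z n j)).
    { apply Rmult_le_pos; auto. apply sumN_nonneg. intros i Hi. specialize (HZ n i Hi).
      left; apply Rinv_0_lt_compat; lra. }
    assert (Hl : 0 <= l) by now apply sumN_nonneg.
    assert ((3 * D + 1 + l) / S n <= 3 * D + 1 + l).
    { pose proof (HZ n 0%nat ltac:(lia)).
      assert (Z n 0%nat <= S n).
      { apply sumN_term_le; [lia|]. intros m Hm; specialize (HZ n m Hm); lra. }
      apply (Rmult_le_reg_r (S n)); [lra|]. unfold Rdiv. rewrite Rmult_assoc, Rinv_l by lra. nra. }
    lra. }
  assert (Hln : - K <= ln (share n j)).
  { pose proof (sumN_except d j (fun i => ln (share n i)) Hj) as E.
    change (sumN d (fun i => ln (share n i))) with (entropy n) in E.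
    assert (sumN d (fun i => if Nat.eqb i j then 0 else ln (share n i)) <= D * ln D).
    { change (D * ln D) with (INR d * ln D). rewrite <- sumN_const. apply sumN_le. intros i Hi. destruct Nat.eqb; auto.
      destruct (Hsh i Hi). apply ln_le; auto. }
    unfold K. lra. }
  assert (He : exp (- K) <= share n j).
  { rewrite <- (exp_ln (share n j)) by apply (Hsh j Hj).
    destruct Hln as [Hln|Hln]; [left; now apply exp_increasing|right; now rewrite Hln]. }
  unfold share in He. apply (Rmult_le_compat_r (T n)) in He; [|lra].
  apply (Rmult_le_reg_l D); [lra|].
  replace (D * (exp (- K) / D * T n)) with (exp (- K) * T n) by (field; lra).
  replace (D * Z n j) with (D * (Z n j / T n) * T n) by (field; lra). auto.
Qed.

(** Now that every [Z n j] is at least c T, the pole terms and the corrector in [Q_entropy] are O(1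
    / T). *)
Lemma entropy_cv : Un_cv entropy (3 * D + 1 + l - q).
Proof.
  destruct path_proportional as (c & Hc & HcZ). pose proof path_D_ge_3 as HD.
  assert (Hl : 0 <= l) by now apply sumN_nonneg.
  set (K := (b * D + (3 * D + 1 + l)) / c).
  assert (HK : 0 <= K).
  { apply Rmult_le_pos; [|left; now apply Rinv_0_lt_compat].
    assert (0 <= b * D) by (apply Rmult_le_pos; lra). lra. }
  assert (Hr : forall n, Rabs (entropy n - (3 * D + 1 + l - Q n)) <= K / T n).
  { intros n. destruct (path_T n) as (HT1 & HST & _). rewrite Q_entropy.
    match goal with |- Rabs ?e <= _ => replace e with (b * sumN d (fun j => / Z n j) +
      corrector D (Z n (pos n)) (L n (pos n)) (S n) (T n)) by ring end.
    assert (Hinv : forall x, c * T n <= x -> 0 < / x <= / (c * T n)).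
    { intros x Hx. assert (0 < c * T n) by (apply Rmult_lt_0_compat; lra).
      split; [apply Rinv_0_lt_compat; lra|apply Rinv_le_contravar; lra]. }
    assert (H1 : 0 <= sumN d (fun j => / Z n j) <= D * / (c * T n)).
    { split; [apply sumN_nonneg|unfold D; rewrite <- sumN_const; apply sumN_le]; intros j Hj;
        pose proof (Hinv _ (HcZ n j Hj)); lra. }
    pose proof (corrector_abs_le d (Z n) (L n) l0 Hd (HZ n) Hl0 (HL n) (pos n) (Hpos n)) as H2.
    fold D l (S n) in H2. change (S n + sumN d (L n)) with (T n) in H2.
    assert (H3 : 0 < / S n <= / (c * T n)).
    { apply Hinv. apply Rle_trans with (Z n 0%nat); [apply HcZ; lia|].
      apply sumN_term_le; [lia|]. intros m Hm; specialize (HZ n m Hm); lra. }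
    eapply Rle_trans; [apply Rabs_triang|]. rewrite (Rabs_pos_eq (b * _)) by (apply Rmult_le_pos; lra).
    replace (K / T n) with (b * (D * / (c * T n)) + (3 * D + 1 + l) * / (c * T n)) by (unfold K; field; lra).
    apply Rplus_le_compat; [apply Rmult_le_compat_l; lra|].
    apply Rle_trans with (1 := H2). apply Rmult_le_compat_l; lra. }
  intros eps Heps.
  destruct (HQ (eps / 2)) as (N1 & HN1); [lra|].
  destruct (INR_unbounded (2 * K / eps)) as (N2 & HN2).
  exists (N1 + N2)%nat. intros n Hn.
  specialize (HN1 n ltac:(lia)). unfold Rdist in *.
  assert (HT2 : 2 * K / eps < T n).
  { pose proof (HT n). assert (INR N2 <= INR n) by (apply le_INR; lia). lra. }
  assert (HKT : K / T n < eps / 2).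
  { destruct (path_T n) as (HT1 & _).
    apply (Rmult_lt_reg_r (T n * 2 / eps)).
    - apply Rdiv_lt_0_compat; lra.
    - replace (K / T n * (T n * 2 / eps)) with (2 * K / eps) by (field; lra).
      replace (eps / 2 * (T n * 2 / eps)) with (T n) by (field; lra). auto. }
  replace (entropy n - (3 * D + 1 + l - q)) with
    ((entropy n - (3 * D + 1 + l - Q n)) + - (Q n - q)) by ring.
  eapply Rle_lt_trans; [apply Rabs_triang|]. rewrite Rabs_Ropp. specialize (Hr n). lra.
Qed.

Lemma gain_bound eps n : 0 < eps -> inner n = true ->
  eps ^ 2 * T n ^ 2 <= rate d (Z n) (L n) + D * l * T n ->
  eps ^ 2 / (tau + INR n + 1) <= G (Datatypes.S n) - G n.
Proof.
  intros He Hi Hr. rewrite HG, Hi. destruct (path_T n) as (HT1 & HST & HLT).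
  set (rho := rate d (Z n) (L n) + D * l * T n) in *.
  pose proof (Hpos n) as Hp. pose proof (HZ n _ Hp) as HZp. pose proof (HL n _ Hp) as HLp.
  set (N := S n - Z n (pos n) + L n (pos n)).
  assert (HLk : L n (pos n) <= sumN d (L n)) by (apply sumN_term_le; auto; intros j Hj; now apply HL).
  assert (HN : 0 < N <= T n).
  { split; [|unfold N, T; fold (S n); lra].
    pose proof (sumN_except d (pos n) (Z n) Hp) as E. fold (S n) in E.
    assert (Hj : exists j, (j < d)%nat /\ j <> pos n).
    { destruct (Nat.eq_dec (pos n) 0); [exists 1%nat|exists 0%nat]; lia. }
    destruct Hj as (j & Hj & Hne).
    assert (Z n j <= sumN d (fun j => if Nat.eqb j (pos n) then 0 else Z n j)).
    { pose proof (sumN_term_le d j (fun j => if Nat.eqb j (pos n) then 0 else Z n j) Hj) as Ht.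
      cbv beta in Ht. destruct (Nat.eqb_spec j (pos n)); [contradiction|]. apply Ht.
      intros i Hi'. specialize (HZ n i Hi'). destruct Nat.eqb; lra. }
    pose proof (HZ n j Hj). unfold N. lra. }
  assert (HS : 0 < S n).
  { pose proof (HZ n 0%nat ltac:(lia)). assert (Z n 0%nat <= S n); [|lra].
    apply sumN_term_le; [lia|]. intros m Hm; specialize (HZ n m Hm); lra. }
  pose proof (HT n) as HTn. pose proof (pos_INR n).
  apply Rle_trans with (eps ^ 2 / T n).
  - apply Rmult_le_compat_l; [apply pow2_ge_0|]. apply Rinv_le_contravar; lra.
  - replace (G n + rho / (T n * S n) / N - G n) with (rho / (T n * S n * N)) by (field; lra).
    assert (0 < T n * S n) by (apply Rmult_lt_0_compat; lra).
    apply div_le_div; [lra|apply Rmult_lt_0_compat; lra|].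
    apply Rle_trans with (eps ^ 2 * T n ^ 2 * T n); [|apply Rmult_le_compat_r; lra].
    replace (eps ^ 2 * T n ^ 2 * T n) with (eps ^ 2 * (T n * T n * T n)) by ring.
    apply Rmult_le_compat_l; [apply pow2_ge_0|].
    apply Rmult_le_compat; try lra. apply Rmult_le_compat; lra.
Qed.

(* The accumulated gain is bounded, while gains of at least [eps ^ 2 / t] at
   every second step would sum to infinity like the harmonic series. *)
Lemma rate_small_often eps N : 0 < eps -> exists n, (N <= n)%nat /\
  rate d (Z n) (L n) + D * l * T n <= eps ^ 2 * T n ^ 2.
Proof.
  intros He. apply NNPP. intros Hn.
  assert (Hlow : forall n, (N <= n)%nat -> eps ^ 2 * T n ^ 2 <= rate d (Z n) (L n) + D * l * T n).
  { intros n HNn. apply Rlt_le, Rnot_le_lt. intros H; apply Hn; eauto. }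
  (* The offset 2 bounds [T] at both times [n] and [n + 1], whichever of them is interior. *)
  set (t n := tau + INR n + 2).
  assert (Ht : forall n, 2 <= t n) by (intros n; unfold t; pose proof (pos_INR n); lra).
  assert (Hmono : forall n, G n <= G (Datatypes.S n)).
  { intros n. rewrite HG. destruct (inner n); [|lra]. destruct (path_T n) as (HT1 & HST & HLT).
    pose proof (rate_nonneg d (Z n) (L n) l0 Hd (HZ n) Hl0 (HL n)) as Hr.
    fold D l (S n) in Hr. change (S n + sumN d (L n)) with (T n) in Hr.
    pose proof (Hpos n) as Hp. pose proof (HL n _ Hp).
    assert (HZS : Z n (pos n) <= S n).
    { apply sumN_term_le; auto. intros m Hm; specialize (HZ n m Hm); lra. }
    pose proof (HZ n _ Hp).
    enough (0 <= (rate d (Z n) (L n) + D * l * T n) / (T n * S n) / (S n - Z n (pos n) + L n (pos n))) by lra.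
    assert (Hinv : forall x, 0 <= x -> 0 <= / x).
    { intros x [Hx|<-]; [left; now apply Rinv_0_lt_compat|rewrite Rinv_0; lra]. }
    apply Rmult_le_pos; [apply Rmult_le_pos; auto|]; apply Hinv; [|lra].
    apply Rmult_le_pos; lra. }
  assert (Hstep : forall n, (N <= n)%nat ->
    eps ^ 2 * (ln (t n + 1) - ln (t n)) <= G (Datatypes.S (Datatypes.S n)) - G n).
  { intros n HNn. pose proof (Ht n) as Htn. pose proof (ln_shift_le (t n) 1 ltac:(lra) ltac:(lra)) as Hln.
    apply Rle_trans with (eps ^ 2 / t n).
    { apply Rmult_le_compat_l; [apply pow2_ge_0|]. lra. }
    destruct (Hinner n) as [Hi|Hi].
    - pose proof (gain_bound eps n He Hi (Hlow n HNn)) as Hg. pose proof (Hmono (Datatypes.S n)).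
      assert (eps ^ 2 / t n <= eps ^ 2 / (tau + INR n + 1)); [|lra].
      apply Rmult_le_compat_l; [apply pow2_ge_0|]. pose proof (pos_INR n).
      apply Rinv_le_contravar; unfold t; lra.
    - pose proof (gain_bound eps _ He Hi (Hlow (Datatypes.S n) ltac:(lia))) as Hg. pose proof (Hmono n).
      rewrite S_INR in Hg. replace (tau + (INR n + 1) + 1) with (t n) in Hg by (unfold t; ring). lra. }
  (* The two-step increments overlap; their sum telescopes to two consecutive values of [G] at the
     end minus two at the start, hence is at most 2 B. *)
  assert (Hsum : forall m, eps ^ 2 * (ln (t (N + m)%nat) - ln (t N)) <=
      G (N + m)%nat + G (Datatypes.S (N + m))).
  { induction m as [|m IH].
    - rewrite Nat.add_0_r. pose proof (HGB N). pose proof (HGB (Datatypes.S N)). lra.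
    - rewrite Nat.add_succ_r. pose proof (Hstep (N + m)%nat ltac:(lia)) as Hs.
      replace (t (Datatypes.S (N + m))) with (t (N + m)%nat + 1) by (unfold t; rewrite S_INR; ring).
      lra. }
  assert (He2 : 0 < eps ^ 2) by (apply pow_lt; auto).
  set (M := 2 * B / eps ^ 2 + ln (t N)).
  destruct (INR_unbounded (exp M)) as (m & Hm).
  assert (Hbig : M < ln (t (N + m)%nat)).
  { rewrite <- (ln_exp M). apply ln_increasing; [apply exp_pos|]. unfold t.
    assert (INR m <= INR (N + m)) by (apply le_INR; lia). lra. }
  pose proof (Hsum m). pose proof (HGB (N + m)%nat). pose proof (HGB (Datatypes.S (N + m))).
  assert (eps ^ 2 * (2 * B / eps ^ 2) < eps ^ 2 * (ln (t (N + m)%nat) - ln (t N))).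
  { apply Rmult_lt_compat_l; auto. unfold M in Hbig. lra. }
  replace (eps ^ 2 * (2 * B / eps ^ 2)) with (2 * B) in * by (field; lra). lra.
Qed.

(** A limit p < 0 keeps the entropy eventually below p / 2, while at a late time with small rate it
    is at least p / 2. *)
Lemma entropy_limit_nonneg : 0 <= 3 * D + 1 + l - q.
Proof.
  set (p := 3 * D + 1 + l - q). destruct (Rle_or_lt 0 p) as [|Hp]; auto. exfalso.
  destruct path_proportional as (c & Hc & HcZ). pose proof path_D_ge_3 as HD.
  set (eps := Rmin (c / 2) (c * (- p / 2) / (5 * D))).
  assert (He : 0 < eps).
  { apply Rmin_pos; [lra|]. apply Rdiv_lt_0_compat; [|lra]. apply Rmult_lt_0_compat; lra. }
  assert (He1 : 2 * eps <= c) by (pose proof (Rmin_l (c / 2) (c * (- p / 2) / (5 * D))); fold eps in H; lra).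
  assert (He2 : 5 * D * eps / c <= - p / 2).
  { apply (Rmult_le_reg_r (c / (5 * D))); [apply Rdiv_lt_0_compat; lra|].
    replace (5 * D * eps / c * (c / (5 * D))) with eps by (field; lra).
    replace (- p / 2 * (c / (5 * D))) with (c * (- p / 2) / (5 * D)) by (field; lra). apply Rmin_r. }
  destruct (entropy_cv (- p / 2)) as (N1 & HN1); [lra|]. fold p in HN1.
  destruct (INR_unbounded (4 * l / c)) as (N2 & HN2).
  destruct (rate_small_often eps (N1 + N2) He) as (n & Hn & Hr).
  assert (HcT : 4 * l <= c * T n).
  { pose proof (HT n). assert (INR N2 <= INR n) by (apply le_INR; lia).
    replace (4 * l) with (c * (4 * l / c)) by (field; lra). apply Rmult_le_compat_l; lra. }
  pose proof (entropy_near_uniform d (Z n) (L n) l0 Hd (HZ n) Hl0 (HL n) c eps He He1 (HcZ n) HcT Hr) as H.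
  change (- (5 * D * eps / c) <= entropy n) in H.
  specialize (HN1 n ltac:(lia)). unfold Rdist in HN1. apply Rabs_def2 in HN1. lra.
Qed.

Lemma path_share_cv j : (j < d)%nat -> Un_cv (fun n => Z n j / T n) (/ D).
Proof.
  intros Hj eps Heps. pose proof path_D_ge_3 as HD. pose proof entropy_limit_nonneg as Hp.
  (* If the square root s of a share satisfies |s - 1| <= h <= 1, then |s^2 - 1| <= h (2 + h) <= 3 h
     <= eps. *)
  set (h := Rmin 1 (eps / 3)).
  assert (Hh : 0 < h) by (apply Rmin_pos; lra).
  destruct (entropy_cv (h ^ 2)) as (N & HN); [now apply pow_lt|]. exists N. intros n Hn.
  specialize (HN n Hn). unfold Rdist in *. apply Rabs_def2 in HN.
  pose proof (entropy_deficit d (Z n) (L n) l0 Hd (HZ n) (HL n) j Hj) as Hdef.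
  pose proof (share_pos d (Z n) (L n) l0 Hd (HZ n) (HL n) j Hj) as Hsp.
  change (0 < share n j) in Hsp. change ((sqrt (share n j) - 1) ^ 2 <= - entropy n) in Hdef.
  pose proof (sqrt_sqrt (share n j) ltac:(lra)) as Hss. pose proof (sqrt_pos (share n j)) as Hs0.
  set (s := sqrt (share n j)) in *.
  assert (Hs : Rabs (s - 1) <= h).
  { rewrite <- (Rabs_pos_eq h) by lra. apply Rsqr_le_abs_0. unfold Rsqr. nra. }
  apply Rabs_le_inv in Hs.
  assert (Hh1 : h <= 1) by apply Rmin_l. assert (Hh3 : h <= eps / 3) by apply Rmin_r.
  assert (Hx : Rabs (share n j - 1) <= eps).
  { apply Rabs_le. rewrite <- Hss. nra. }
  replace (Z n j / T n - / D) with ((share n j - 1) * / D) by (unfold share; field; destruct (path_T n); lra).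
  rewrite Rabs_mult, (Rabs_pos_eq (/ D)) by (left; apply Rinv_0_lt_compat; lra).
  assert (/ D < 1) by (rewrite <- Rinv_1; apply Rinv_lt_contravar; lra).
  assert (0 < / D) by (apply Rinv_0_lt_compat; lra). pose proof (Rabs_pos (share n j - 1)). nra.
Qed.

End PathLimit.

(** * Application to the walk *)

Lemma sumL_verts d r f : sumL (verts d r) f =
  sumN d (fun j => f (Int j)) + sumN d (fun j => sumN (r j) (fun m => f (Leaf j m))).
Proof.
  unfold verts. rewrite sumL_app, sumL_map, sumL_flat_map. f_equal.
  apply sumN_ext. intros j _. now rewrite sumL_map.
Qed.

Lemma sum_nbrs_interior d r k f : (k < d)%nat ->
  sumR (filter (adjb d r (Int k)) (verts d r)) f =
  sumN d (fun j => if Nat.eqb j k then 0 else f (Int j)) + sumN (r k) (fun m => f (Leaf k m)).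
Proof.
  intros Hk. change (sumL (filter (adjb d r (Int k)) (verts d r)) f =
    sumN d (fun j => if Nat.eqb j k then 0 else f (Int j)) + sumN (r k) (fun m => f (Leaf k m))).
  rewrite sumL_filter, sumL_verts. apply Nat.ltb_lt in Hk as Hk'. f_equal.
  - apply sumN_ext. intros j Hj. apply Nat.ltb_lt in Hj. unfold adjb; simpl.
    rewrite Hk', Hj, Nat.eqb_sym. now destruct Nat.eqb.
  - rewrite <- (sumN_single d k (fun i => sumN (r i) (fun m => f (Leaf i m))) Hk).
    apply sumN_ext. intros j Hj. apply Nat.ltb_lt in Hj. destruct (Nat.eqb_spec j k) as [->|Hne].
    + apply sumN_ext. intros m Hm. apply Nat.ltb_lt in Hm. unfold adjb; simpl.
      now rewrite Hk', Hm, Nat.eqb_refl.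
    + rewrite (sumN_ext _ _ (fun _ => 0)); [rewrite sumN_const; lra|]. intros m _.
      unfold adjb; simpl. apply Nat.eqb_neq in Hne. rewrite Nat.eqb_sym, Hne.
      now rewrite Bool.andb_false_r.
Qed.

Lemma sum_nbrs_leaf d r k m f : (k < d)%nat -> (m < r k)%nat ->
  sumR (filter (adjb d r (Leaf k m)) (verts d r)) f = f (Int k).
Proof.
  intros Hk Hm. change (sumL (filter (adjb d r (Leaf k m)) (verts d r)) f = f (Int k)).
  rewrite sumL_filter, sumL_verts. apply Nat.ltb_lt in Hk as Hk'. apply Nat.ltb_lt in Hm.
  rewrite (sumN_ext d (fun j => sumN _ _) (fun _ => 0)).
  - rewrite sumN_const. rewrite <- (sumN_single d k (fun j => f (Int j)) Hk).
    rewrite Rmult_0_r, Rplus_0_r. apply sumN_ext. intros j Hj. apply Nat.ltb_lt in Hj.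
    unfold adjb; simpl. rewrite Hk', Hj, Hm, Nat.eqb_sym. reflexivity.
  - intros j _. rewrite (sumN_ext _ _ (fun _ => 0)); [rewrite sumN_const; lra|]. intros i _.
    unfold adjb. now rewrite Bool.andb_false_r.
Qed.

Lemma trans_sum d r z0 omega n f :
  sumL (verts d r) (fun w => trans d r z0 omega n w * f w) =
  sumR (filter (adjb d r (omega n)) (verts d r)) (fun w => Zw z0 omega n w * f w)
  / sumR (filter (adjb d r (omega n)) (verts d r)) (Zw z0 omega n).
Proof.
  set (N := sumR (filter (adjb d r (omega n)) (verts d r)) (Zw z0 omega n)).
  change (sumR (filter (adjb d r (omega n)) (verts d r)) (fun w => Zw z0 omega n w * f w))
    with (sumL (filter (adjb d r (omega n)) (verts d r)) (fun w => Zw z0 omega n w * f w)).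
  rewrite sumL_filter. unfold Rdiv. rewrite Rmult_comm, <- sumL_scal. apply sumL_ext.
  intros w _. unfold trans. fold N. destruct adjb; unfold Rdiv; ring.
Qed.

Lemma Zw_upd z0 omega n w v :
  Zw z0 (upd omega (S n) w) (S n) v = Zw z0 omega n v + if vtx_eq_dec w v then 1 else 0.
Proof.
  unfold Zw. cbn [visits]. rewrite upd_eq.
  rewrite (visits_adapted v (upd omega (S n) w) omega n) by (apply agree_upd; lia).
  rewrite Nat.add_assoc, plus_INR. destruct vtx_eq_dec; simpl; lra.
Qed.

Lemma upd_self omega n : upd omega n (omega n) = omega.
Proof.
  apply functional_extensionality. intros m. unfold upd.
  destruct (Nat.eqb_spec m n); congruence.
Qed.

Definition base (v : vtx) : nat := match v with Int i => i | Leaf i _ => i end.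

(* At a leaf of [j] the next step leads back to [j] for sure, so that visit to [j] is
   counted ahead of time: the Lyapunov function does not change on the way back. *)
Definition eff_weight (z0 : vtx -> nat) (omega : path) (n j : nat) : R :=
  Zw z0 omega n (Int j) +
  match omega n with Int _ => 0 | Leaf i _ => if Nat.eqb j i then 1 else 0 end.

Definition leaf_weight (r : nat -> nat) (z0 : vtx -> nat) (omega : path) (n j : nat) : R :=
  sumN (r j) (fun m => Zw z0 omega n (Leaf j m)).

(** * Effect of one step on the weights *)

Section Weights.

Context (d : nat) (r : nat -> nat) (z0 : vtx -> nat).

Let Zh := eff_weight z0.
Let Lh := leaf_weight r z0.

Lemma eff_weight_int omega n k : omega n = Int k ->
  Zh omega n = fun j => Zw z0 omega n (Int j).
Proof.
  intros H. apply functional_extensionality. intros j. unfold Zh, eff_weight. rewrite H. lra.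
Qed.

Lemma leaf_weight_to_int omega n j :
  Lh (upd omega (S n) (Int j)) (S n) = Lh omega n.
Proof.
  apply functional_extensionality. intros i. apply sumN_ext. intros m _.
  rewrite Zw_upd. destruct vtx_eq_dec; [discriminate|lra].
Qed.

Lemma eff_weight_jump omega n k j : omega n = Int k ->
  Zh (upd omega (S n) (Int j)) (S n) = bump (Zh omega n) j.
Proof.
  intros H. apply functional_extensionality. intros i. rewrite (eff_weight_int omega n k H).
  unfold Zh, eff_weight, bump. rewrite upd_eq, Zw_upd.
  destruct (Nat.eqb_spec i j), vtx_eq_dec; congruence || lra.
Qed.

(** The step to the leaf does not visit [Int k]; the increment is the return counted ahead. *)
Lemma eff_weight_loop omega n k m : omega n = Int k ->
  Zh (upd omega (S n) (Leaf k m)) (S n) = bump (Zh omega n) k.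
Proof.
  intros H. apply functional_extensionality. intros i. rewrite (eff_weight_int omega n k H).
  unfold Zh, eff_weight, bump. rewrite upd_eq, Zw_upd.
  destruct vtx_eq_dec; [discriminate|]. destruct Nat.eqb; lra.
Qed.

Lemma leaf_weight_loop omega n k m : (m < r k)%nat ->
  Lh (upd omega (S n) (Leaf k m)) (S n) = bump (Lh omega n) k.
Proof.
  intros Hm. apply functional_extensionality. intros i. unfold Lh, leaf_weight, bump.
  rewrite (sumN_ext _ _ (fun m' => Zw z0 omega n (Leaf i m') + if vtx_eq_dec (Leaf k m) (Leaf i m') then 1 else 0))
    by (intros; apply Zw_upd).
  rewrite sumN_plus. destruct (Nat.eqb_spec i k) as [->|Hne].
  - f_equal. transitivity (sumN (r k) (fun j => if Nat.eqb j m then 1 else 0));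
      [|exact (sumN_single (r k) m (fun _ => 1) Hm)]. apply sumN_ext. intros m' _.
    destruct vtx_eq_dec, (Nat.eqb_spec m' m); congruence.
  - enough (sumN (r i) (fun m' => if vtx_eq_dec (Leaf k m) (Leaf i m') then 1 else 0) = 0) by lra.
    rewrite (sumN_ext _ _ (fun _ => 0)); [rewrite sumN_const; lra|]. intros m' _. destruct vtx_eq_dec; congruence.
Qed.

Lemma eff_weight_return omega n k m : omega n = Leaf k m ->
  Zh (upd omega (S n) (Int k)) (S n) = Zh omega n.
Proof.
  intros H. apply functional_extensionality. intros i.
  unfold Zh, eff_weight. rewrite upd_eq, Zw_upd, H.
  destruct (Nat.eqb_spec i k), vtx_eq_dec; congruence || lra.
Qed.

Lemma eff_weight_adapted : adapted Zh.
Proof.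
  intros o o' n H. apply functional_extensionality. intros j. unfold Zh, eff_weight.
  rewrite (H n) by lia. now rewrite (Zw_adapted z0 (Int j) o o' n H).
Qed.

Lemma leaf_weight_adapted : adapted Lh.
Proof.
  intros o o' n H. apply functional_extensionality. intros j. apply sumN_ext. intros m _.
  apply (Zw_adapted z0 (Leaf j m) o o' n H).
Qed.

End Weights.

(** * The walk along words of positive probability *)

Section Reinforced.

Context (d : nat) (r : nat -> nat) (z0 : vtx -> nat) (x0 : vtx).

Context (Hd : (3 <= d)%nat).
Context (Hz0 : forall v, valid d r v -> (1 <= z0 v)%nat).
Context (Hx0 : valid d r x0).

Let D := INR d.
Let Zh := eff_weight z0.
Let Lh := leaf_weight r z0.
Let l0 j := sumN (r j) (fun m => INR (z0 (Leaf j m))).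
Let l := sumN d l0.
Let b := pole_weight d (1 + l) (D * l).
Let cyl := cylP d r z0 x0.
Let S omega n := sumN d (Zh omega n).
Let T omega n := sumN d (Zh omega n) + sumN d (Lh omega n).

Lemma walk_valid omega n : 0 < cyl omega n -> valid d r (omega n).
Proof.
  intros H. destruct n as [|n].
  - now rewrite (cylP_0 d r z0 x0 omega 0 H).
  - destruct (cylP_S_pos d r z0 x0 omega n H) as [_ Ht]. unfold trans, adjb in Ht. unfold valid.
    destruct (validb d r (omega (Datatypes.S n))); auto. rewrite Bool.andb_false_r in Ht. simpl in Ht. lra.
Qed.

Lemma walk_step omega n : 0 < cyl omega (Datatypes.S n) ->
  (exists k j, (k < d)%nat /\ (j < d)%nat /\ omega n = Int k /\ omega (Datatypes.S n) = Int j) \/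
  (exists k m, (k < d)%nat /\ (m < r k)%nat /\ omega n = Int k /\ omega (Datatypes.S n) = Leaf k m) \/
  (exists k m, (k < d)%nat /\ (m < r k)%nat /\ omega n = Leaf k m /\ omega (Datatypes.S n) = Int k).
Proof.
  intros H. destruct (cylP_S_pos d r z0 x0 omega n H) as [_ Ht]. unfold trans, adjb in Ht.
  destruct (omega n) as [k|k m], (omega (Datatypes.S n)) as [j|j i]; simpl in Ht;
    match type of Ht with 0 < if ?c then _ else _ => destruct c eqn:E; [clear Ht|lra] end;
    repeat rewrite Bool.andb_true_iff in E; rewrite ?Nat.ltb_lt, ?Nat.eqb_eq in E.
  - left. exists k, j. tauto.
  - right; left. exists k, i. destruct E as [[? [? ?]] <-]. auto.
  - right; right. exists k, m. destruct E as [[[? ?] ?] <-]. auto.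
  - destruct E as [_ E]. discriminate.
Qed.

Lemma Zw_ge_1 omega n v : valid d r v -> 1 <= Zw z0 omega n v.
Proof. intros H. apply Hz0 in H. unfold Zw. apply (le_INR 1). lia. Qed.

Lemma eff_weight_ge_1 omega n j : (j < d)%nat -> 1 <= Zh omega n j.
Proof.
  intros Hj. unfold Zh, eff_weight. assert (1 <= Zw z0 omega n (Int j)).
  { apply Zw_ge_1. now apply Nat.ltb_lt. }
  destruct (omega n); [lra|]. destruct Nat.eqb; lra.
Qed.

Lemma leaf_init_nonneg j : (j < d)%nat -> 0 <= l0 j.
Proof. intros _. apply sumN_nonneg. intros; apply pos_INR. Qed.

(** Each step to a leaf raises the leaf weight and the effective weight of its neighbour together,
    so only the initial leaf weights are uncompensated. *)
Lemma leaf_weight_le omega n : 0 < cyl omega n ->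
  forall j, (j < d)%nat -> 0 <= Lh omega n j <= Zh omega n j + l0 j.
Proof.
  intros Hc j Hj. split; [apply sumN_nonneg; intros; apply pos_INR|].
  induction n as [|n IH].
  - assert (Lh omega 0%nat j = l0 j).
    { apply sumN_ext. intros m _. unfold Zw. simpl. now rewrite Nat.add_0_r. }
    pose proof (eff_weight_ge_1 omega 0 j Hj). lra.
  - specialize (IH (proj1 (cylP_S_pos d r z0 x0 omega n Hc))). rewrite <- (upd_self omega (Datatypes.S n)).
    destruct (walk_step omega n Hc) as [(k & i & Hk & Hi & E1 & ->)|[(k & m & Hk & Hm & E1 & ->)|(k & m & Hk & Hm & E1 & ->)]].
    + unfold Lh, Zh. rewrite leaf_weight_to_int, (eff_weight_jump z0 omega n k i E1).
      fold Lh Zh. unfold bump. destruct Nat.eqb; lra.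
    + unfold Lh, Zh. rewrite (leaf_weight_loop r z0 omega n k m Hm), (eff_weight_loop z0 omega n k m E1).
      fold Lh Zh. unfold bump. destruct Nat.eqb; lra.
    + unfold Lh, Zh. rewrite leaf_weight_to_int, (eff_weight_return z0 omega n k m E1). exact IH.
Qed.

Lemma total_weight omega n : 0 < cyl omega n ->
  sumL (verts d r) (Zw z0 omega n) = INR (t0 d r z0 + n).
Proof.
  induction n as [|n IH]; intros Hc.
  - rewrite (sumL_ext _ _ (fun v => INR (z0 v))) by (intros; unfold Zw; simpl; now rewrite Nat.add_0_r).
    rewrite Nat.add_0_r. unfold t0. induction (verts d r) as [|v vs IHv]; [reflexivity|].
    rewrite sumL_cons, IHv. simpl. now rewrite plus_INR.
  - specialize (IH (proj1 (cylP_S_pos d r z0 x0 omega n Hc))).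
    rewrite Nat.add_succ_r, S_INR, <- IH. pose proof (walk_valid omega _ Hc) as Hv.
    rewrite (sumL_ext _ _ (fun v => Zw z0 omega n v + if vtx_eq_dec v (omega (Datatypes.S n)) then 1 else 0)).
    + rewrite sumL_plus, (sumL_indicator vtx_eq_dec _ _ (fun _ => 1)) by apply nodup_verts.
      destruct in_dec as [|Hn]; auto. destruct Hn. now apply in_verts.
    + intros v _. rewrite <- (upd_self omega (Datatypes.S n)) at 1. rewrite Zw_upd.
      destruct (vtx_eq_dec (omega (Datatypes.S n)) v), (vtx_eq_dec v (omega (Datatypes.S n))); congruence.
Qed.

Definition leaf_flag (v : vtx) : R := match v with Int _ => 0 | Leaf _ _ => 1 end.

Lemma eff_total omega n : 0 < cyl omega n ->
  T omega n = INR (t0 d r z0 + n) + leaf_flag (omega n).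
Proof.
  intros Hc. rewrite <- (total_weight omega n Hc), sumL_verts. unfold T, Zh, eff_weight.
  rewrite sumN_plus. change (sumN d (fun j => sumN (r j) (fun m => Zw z0 omega n (Leaf j m))))
    with (sumN d (Lh omega n)).
  pose proof (walk_valid omega n Hc) as Hv. destruct (omega n) as [i|i m]; simpl.
  - rewrite sumN_const. lra.
  - unfold valid, validb in Hv. apply andb_prop in Hv. destruct Hv as [Hi _]. apply Nat.ltb_lt in Hi.
    rewrite (sumN_single d i (fun _ => 1) Hi). lra.
Qed.

(** The distance of the Lyapunov function to its upper bound in [lyapunov_le]. *)
Definition value (omega : path) (n : nat) : R :=
  3 * D + 1 + l - D * ln D - lyapunov d b (base (omega n)) (Zh omega n) (Lh omega n).

Definition gain (omega : path) (n : nat) : R :=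
  match omega n with
  | Int k => (rate d (Zh omega n) (Lh omega n) + D * l * T omega n) / (T omega n * S omega n)
             / (S omega n - Zh omega n k + Lh omega n k)
  | Leaf _ _ => 0
  end.

Lemma base_lt omega n : 0 < cyl omega n -> (base (omega n) < d)%nat.
Proof.
  intros Hc. pose proof (walk_valid omega n Hc) as H. destruct (omega n); simpl.
  - now apply Nat.ltb_lt.
  - unfold valid, validb in H. apply andb_prop in H. destruct H. now apply Nat.ltb_lt.
Qed.

Lemma l_ge_0 : 0 <= l.
Proof. apply sumN_nonneg. exact leaf_init_nonneg. Qed.

Lemma Dl_ge_0 : 0 <= D * l.
Proof. apply Rmult_le_pos; [apply pos_INR|apply l_ge_0]. Qed.

Lemma b_ge_0 : 0 <= b.
Proof.
  unfold b, pole_weight. fold D. pose proof (pos_INR d) as HD. fold D in HD. pose proof l_ge_0.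
  pose proof Dl_ge_0. pose proof (pow2_ge_0 (1 + l)). lra.
Qed.

Lemma value_nonneg omega n : 0 < cyl omega n -> 0 <= value omega n.
Proof.
  intros Hc. unfold value.
  pose proof (lyapunov_le d (Zh omega n) (Lh omega n) l0 Hd (eff_weight_ge_1 omega n) leaf_init_nonneg
    (leaf_weight_le omega n Hc) b (base (omega n)) b_ge_0 (base_lt omega n Hc)) as H.
  fold D l in H. lra.
Qed.

Lemma exit_weight_pos omega n k : 0 < cyl omega n -> (k < d)%nat ->
  0 < S omega n - Zh omega n k + Lh omega n k.
Proof.
  intros Hc Hk. pose proof (leaf_weight_le omega n Hc k Hk).
  pose proof (sumN_except d k (Zh omega n) Hk) as E. fold (S omega n) in E.
  assert (Hj : exists j, (j < d)%nat /\ j <> k).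
  { destruct (Nat.eq_dec k 0); [exists 1%nat|exists 0%nat]; lia. }
  destruct Hj as (j & Hj & Hne).
  assert (Zh omega n j <= sumN d (fun j => if Nat.eqb j k then 0 else Zh omega n j)).
  { pose proof (sumN_term_le d j (fun j => if Nat.eqb j k then 0 else Zh omega n j) Hj) as Ht.
    cbv beta in Ht. destruct (Nat.eqb_spec j k); [contradiction|]. apply Ht.
    intros i Hi'. pose proof (eff_weight_ge_1 omega n i Hi'). destruct Nat.eqb; lra. }
  pose proof (eff_weight_ge_1 omega n j Hj). lra.
Qed.

Lemma gain_nonneg omega n : 0 < cyl omega n -> 0 <= gain omega n.
Proof.
  intros Hc. unfold gain. pose proof (base_lt omega n Hc) as Hk. destruct (omega n) as [k|]; [|lra].
  simpl in Hk. pose proof (exit_weight_pos omega n k Hc Hk) as HN.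
  pose proof (rate_nonneg d (Zh omega n) (Lh omega n) l0 Hd (eff_weight_ge_1 omega n) leaf_init_nonneg
    (leaf_weight_le omega n Hc)) as Hr.
  destruct (T_pos d (Zh omega n) (Lh omega n) l0 Hd (eff_weight_ge_1 omega n)
    (leaf_weight_le omega n Hc)) as (HT1 & _ & _).
  assert (HS : 1 <= S omega n).
  { apply Rle_trans with (Zh omega n k); [now apply eff_weight_ge_1|].
    apply sumN_term_le; auto. intros i Hi. pose proof (eff_weight_ge_1 omega n i Hi). lra. }
  apply Rmult_le_pos; [apply Rmult_le_pos; [exact Hr|]|]; left; apply Rinv_0_lt_compat; auto.
  apply Rmult_lt_0_compat; [unfold T|]; lra.
Qed.

Lemma drift_interior omega n k f : omega n = Int k -> (k < d)%nat ->
  sumL (verts d r) (fun w => trans d r z0 omega n w * f w) =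
  (sumN d (fun j => if Nat.eqb j k then 0 else Zh omega n j * f (Int j))
    + sumN (r k) (fun m => Zw z0 omega n (Leaf k m) * f (Leaf k m)))
  / (S omega n - Zh omega n k + Lh omega n k).
Proof.
  intros E Hk. rewrite trans_sum, E, !sum_nbrs_interior by auto.
  unfold S, Zh. rewrite (eff_weight_int z0 omega n k E).
  f_equal. rewrite sumN_except by auto. reflexivity.
Qed.

Lemma drift_leaf omega n k m f : omega n = Leaf k m -> (k < d)%nat -> (m < r k)%nat ->
  sumL (verts d r) (fun w => trans d r z0 omega n w * f w) = f (Int k).
Proof.
  intros E Hk Hm. rewrite trans_sum, E, !sum_nbrs_leaf by auto.
  assert (1 <= Zw z0 omega n (Int k)) by (apply Zw_ge_1; now apply Nat.ltb_lt). field. lra.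
Qed.

Lemma walk_cases omega n : 0 < cyl omega n ->
  (exists k, (k < d)%nat /\ omega n = Int k) \/
  (exists k m, (k < d)%nat /\ (m < r k)%nat /\ omega n = Leaf k m).
Proof.
  intros Hc. pose proof (walk_valid omega n Hc) as H. unfold valid, validb in H.
  destruct (omega n) as [k|k m].
  - left. exists k. now rewrite Nat.ltb_lt in H.
  - right. exists k, m. rewrite Bool.andb_true_iff, !Nat.ltb_lt in H. tauto.
Qed.

Lemma trans_total omega n : 0 < cyl omega n -> sumL (verts d r) (trans d r z0 omega n) = 1.
Proof.
  intros Hc. rewrite (sumL_ext _ _ (fun w => trans d r z0 omega n w * 1)) by (intros; ring).
  destruct (walk_cases omega n Hc) as [(k & Hk & E)|(k & m & Hk & Hm & E)].
  - rewrite (drift_interior omega n k _ E Hk). pose proof (exit_weight_pos omega n k Hc Hk) as HN.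
    rewrite (sumN_ext d _ (fun j => if Nat.eqb j k then 0 else Zh omega n j)) by
      (intros; destruct Nat.eqb; ring).
    rewrite sumN_except by auto.
    rewrite (sumN_ext (r k) _ (fun m => Zw z0 omega n (Leaf k m))) by (intros; ring).
    change (sumN (r k) (fun m => Zw z0 omega n (Leaf k m))) with (Lh omega n k).
    fold (S omega n). field. lra.
  - now rewrite (drift_leaf omega n k m _ E Hk Hm).
Qed.

(** All leaves of the current vertex lead to the same effective configuration, so only their total
    weight matters and [lyapunov_drift] applies with [C0 = 1 + l], [C1 = D * l]. From a leaf the
    forced return changes nothing. *)
Lemma value_drift omega n : 0 < cyl omega n ->
  sumL (verts d r) (fun w => trans d r z0 omega n w * value (upd omega (Datatypes.S n) w) (Datatypes.S n))
  <= value omega n - gain omega n.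
Proof.
  intros Hc. destruct (walk_cases omega n Hc) as [(k & Hk & E)|(k & m & Hk & Hm & E)].
  - rewrite (drift_interior omega n k _ E Hk). pose proof (exit_weight_pos omega n k Hc Hk) as HN.
    set (c := 3 * D + 1 + l - D * ln D).
    set (V := fun j => lyapunov d b j (bump (Zh omega n) j) (Lh omega n)).
    set (V' := lyapunov d b k (bump (Zh omega n) k) (bump (Lh omega n) k)).
    rewrite (sumN_ext d _ (fun j => c * (if Nat.eqb j k then 0 else Zh omega n j) +
       (-1) * (if Nat.eqb j k then 0 else Zh omega n j * V j))).
    2:{ intros j _. destruct Nat.eqb; [ring|]. unfold value. rewrite upd_eq. unfold Zh, Lh.
        rewrite leaf_weight_to_int, (eff_weight_jump z0 omega n k j E). fold Zh Lh. simpl base.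
        unfold V, c. ring. }
    rewrite (sumN_ext (r k) _ (fun m => (c - V') * Zw z0 omega n (Leaf k m))).
    2:{ intros m Hm. unfold value. rewrite upd_eq. unfold Zh, Lh.
        rewrite (leaf_weight_loop r z0 omega n k m Hm), (eff_weight_loop z0 omega n k m E).
        fold Zh Lh. simpl base. unfold V', c. ring. }
    rewrite sumN_plus, !sumN_scal, sumN_except by auto.
    change (sumN (r k) (fun m => Zw z0 omega n (Leaf k m))) with (Lh omega n k).
    pose proof (lyapunov_drift d k (1 + l) (D * l) (Zh omega n) (Lh omega n) ltac:(lia) Hk
      ltac:(pose proof l_ge_0; lra) Dl_ge_0 (eff_weight_ge_1 omega n)
      (L_le_scaled_Z d (Zh omega n) (Lh omega n) l0 (eff_weight_ge_1 omega n) leaf_init_nonneg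
         (leaf_weight_le omega n Hc))) as H.
    fold b in H. fold (S omega n) (T omega n) in H. change (S omega n + sumN d (Lh omega n)) with (T omega n) in H.
    change (sumN d (fun j => if Nat.eqb j k then 0 else Zh omega n j * lyapunov d b j (bump (Zh omega n) j) (Lh omega n)))
      with (sumN d (fun j => if Nat.eqb j k then 0 else Zh omega n j * V j)) in H.
    fold V' in H. unfold value, gain. rewrite E. simpl base. fold c (S omega n).
    set (g := (rate d (Zh omega n) (Lh omega n) + D * l * T omega n) / (T omega n * S omega n)) in *.
    set (N := S omega n - Zh omega n k + Lh omega n k) in *.
    set (W := sumN d (fun j => if Nat.eqb j k then 0 else Zh omega n j * V j)) in *.
    set (v := lyapunov d b k (Zh omega n) (Lh omega n)) in *.
    apply (Rmult_le_reg_r N); auto. unfold Rdiv. rewrite Rmult_assoc, Rinv_l, Rmult_1_r by lra.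
    replace ((c - v - g * / N) * N) with (c * N - v * N - g) by (field; lra). unfold N in *. nra.
  - rewrite (drift_leaf omega n k m _ E Hk Hm). unfold value, gain. rewrite E, upd_eq.
    unfold Zh, Lh. rewrite leaf_weight_to_int, (eff_weight_return z0 omega n k m E). simpl base. lra.
Qed.

Lemma value_adapted : adapted value.
Proof.
  intros o o' n H. unfold value, Zh, Lh.
  now rewrite (eff_weight_adapted z0 o o' n H), (leaf_weight_adapted r z0 o o' n H), (H n) by lia.
Qed.

Lemma gain_adapted : adapted gain.
Proof.
  intros o o' n H. unfold gain, T, S, Zh, Lh.
  now rewrite (eff_weight_adapted z0 o o' n H), (leaf_weight_adapted r z0 o o' n H), (H n) by lia.
Qed.

Definition total_gain (omega : path) (n : nat) : R := sumN n (gain omega).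

Lemma total_gain_S omega n : total_gain omega (Datatypes.S n) = total_gain omega n + gain omega n.
Proof.
  unfold total_gain, sumN. rewrite seq_S, sumL_app, sumL_cons.
  change (sumL [] (gain omega)) with 0. rewrite Nat.add_0_l. ring.
Qed.

Lemma cylP_pos_le omega n m : (m <= n)%nat -> 0 < cyl omega n -> 0 < cyl omega m.
Proof.
  induction 1 as [|n Hle IH]; auto. intros Hc. apply IH. exact (proj1 (cylP_S_pos d r z0 x0 omega n Hc)).
Qed.

Lemma value_supermartingale : supermartingale d r z0 x0 value.
Proof.
  split; [exact value_adapted|exact value_nonneg|]. intros omega n Hc.
  pose proof (value_drift omega n Hc). pose proof (gain_nonneg omega n Hc). lra.
Qed.

(** The accumulated gain restores what [value_drift] takes away. It is predictable: its value at
    time [n + 1] depends on the path up to time [n] only. *)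
Lemma value_gain_supermartingale :
  supermartingale d r z0 x0 (fun omega n => value omega n + total_gain omega n).
Proof.
  split.
  - intros o o' n H. rewrite (value_adapted o o' n H). f_equal. apply sumN_ext.
    intros m Hm. apply gain_adapted. intros i Hi; apply H; lia.
  - intros o n Hc. pose proof (value_nonneg o n Hc).
    assert (0 <= total_gain o n); [|lra]. apply sumN_nonneg. intros m Hm.
    apply gain_nonneg, (cylP_pos_le o n m); auto; lia.
  - intros o n Hc. pose proof (value_drift o n Hc) as Hv.
    rewrite (sumL_ext _ _ (fun w => trans d r z0 o n w * value (upd o (Datatypes.S n) w) (Datatypes.S n)
       + (total_gain o n + gain o n) * trans d r z0 o n w)).
    + rewrite sumL_plus, sumL_scal. change (sumL (verts d r) (fun w => trans d r z0 o n w))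
        with (sumL (verts d r) (trans d r z0 o n)). rewrite (trans_total o n Hc). lra.
    + intros w _. rewrite <- total_gain_S. replace (total_gain (upd o (Datatypes.S n) w) (Datatypes.S n))
        with (total_gain o (Datatypes.S n)); [ring|].
      apply sumN_ext. intros m Hm. symmetry. apply gain_adapted, agree_upd. lia.
Qed.

(** * From the supermartingales to the occupation measure *)

Lemma eff_share_cv omega : (forall n, 0 < cyl omega n) ->
  (exists q, Un_cv (value omega) q) ->
  (exists q, Un_cv (fun n => value omega n + total_gain omega n) q) ->
  forall j, (j < d)%nat -> Un_cv (fun n => Zh omega n j / T omega n) (/ D).
Proof.
  intros Hc (q & Hq) (q' & Hq') j Hj.
  (* Since [value] is nonnegative, a bound on the sum also bounds [total_gain]. *)
  destruct (maj_by_pos _ (exist _ q' Hq')) as (B & _ & HB).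
  apply (path_share_cv d b (INR (t0 d r z0)) q B (fun n => Zh omega n) (fun n => Lh omega n) l0
    (fun n => base (omega n)) (fun n => match omega n with Int _ => true | Leaf _ _ => false end)
    (total_gain omega)); auto.
  - exact b_ge_0.
  - intros n i; apply eff_weight_ge_1.
  - exact leaf_init_nonneg.
  - intros n; now apply leaf_weight_le.
  - intros n; now apply base_lt.
  - apply pos_INR.
  - intros n. change (INR (t0 d r z0) + INR n <= T omega n <= INR (t0 d r z0) + INR n + 1).
    rewrite (eff_total omega n (Hc n)), plus_INR. destruct (omega n); simpl; lra.
  - intros n. destruct (walk_step omega n (Hc _)) as [(k & i & _ & _ & -> & _)|[(k & m & _ & _ & -> & _)|(k & m & _ & _ & _ & ->)]]; auto.
  - intros n. rewrite total_gain_S. f_equal. unfold gain. destruct (omega n); auto.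
  - intros n. specialize (HB n). apply Rabs_le_inv in HB. pose proof (value_nonneg omega n (Hc n)).
    split; [|lra]. apply sumN_nonneg. intros m _. now apply gain_nonneg.
Qed.

(** Counting one visit ahead shifts numerator and denominator by at most 1, hence the quotient by at
    most 1 / t. The d interior shares then tend to 1 / d each and exhaust the total mass 1, so
    nothing remains for a leaf. *)
Lemma share_cv_unif omega : (forall n, 0 < cyl omega n) ->
  (forall j, (j < d)%nat -> Un_cv (fun n => Zh omega n j / T omega n) (/ D)) ->
  pi_inf_is_unif d r z0 omega.
Proof.
  intros Hc Hcv.
  assert (Htot : forall n, sumN d (fun j => Zw z0 omega n (Int j)) + sumN d (Lh omega n) = INR (t0 d r z0 + n)).
  { intros n. rewrite <- (total_weight omega n (Hc n)), sumL_verts. reflexivity. }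
  assert (HLnn : forall n i, 0 <= Lh omega n i) by (intros; apply sumN_nonneg; intros; apply pos_INR).
  assert (HZnn : forall n j, 0 <= Zw z0 omega n (Int j)) by (intros; apply pos_INR).
  assert (HZle : forall n j, (j < d)%nat -> Zw z0 omega n (Int j) <= INR (t0 d r z0 + n)).
  { intros n j Hj. rewrite <- Htot.
    pose proof (sumN_term_le d j (fun j => Zw z0 omega n (Int j)) Hj (fun i _ => HZnn n i)) as H.
    pose proof (sumN_nonneg d (Lh omega n) (fun i _ => HLnn n i)). cbv beta in H. lra. }
  assert (Ht : forall n, 1 <= INR (t0 d r z0 + n)).
  { intros n. apply Rle_trans with (2 := HZle n 0%nat ltac:(lia)). apply Zw_ge_1.
    apply Nat.ltb_lt. lia. }
  assert (Hint : forall j, (j < d)%nat -> Un_cv (fun n => pi_emp d r z0 omega n (Int j)) (/ D)).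
  { intros j Hj eps Heps. destruct (Hcv j Hj (eps / 2)) as (N1 & HN1); [lra|].
    destruct (INR_unbounded (2 / eps)) as (N2 & HN2). exists (N1 + N2)%nat. intros n Hn.
    specialize (HN1 n ltac:(lia)). unfold Rdist in *.
    set (t := INR (t0 d r z0 + n)). set (x := Zw z0 omega n (Int j)).
    pose proof (Ht n) as Htn. pose proof (HZle n j Hj) as Hx. pose proof (HZnn n j) as Hx0'.
    fold t in Htn, Hx. fold x in Hx, Hx0'.
    assert (Hclose : Rabs (x / t - Zh omega n j / T omega n) <= / t).
    { assert (Hf : exists f g, 0 <= g <= f /\ f <= 1 /\ T omega n = t + f /\ Zh omega n j = x + g).
      { exists (leaf_flag (omega n)).
        exists (match omega n with Int _ => 0 | Leaf i _ => if Nat.eqb j i then 1 else 0 end).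
        rewrite (eff_total omega n (Hc n)). split; [|split; [|split]]; try reflexivity;
          destruct (omega n) as [i|i m]; simpl; try lra; destruct (Nat.eqb j i); lra. }
      destruct Hf as (f & g & Hg & Hf & -> & ->).
      replace (x / t - (x + g) / (t + f)) with ((x * f - g * t) / (t + f) * / t) by (field; lra).
      rewrite Rabs_mult, (Rabs_pos_eq (/ t)) by (left; apply Rinv_0_lt_compat; lra).
      rewrite <- (Rmult_1_l (/ t)) at 2. apply Rmult_le_compat_r; [left; apply Rinv_0_lt_compat; lra|].
      assert (Hi : 0 < / (t + f)) by (apply Rinv_0_lt_compat; lra).
      unfold Rdiv. rewrite Rabs_mult, (Rabs_pos_eq (/ (t + f))) by lra.
      apply (Rmult_le_reg_r (t + f)); [lra|]. rewrite Rmult_assoc, Rinv_l by lra.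
      rewrite Rmult_1_r, Rmult_1_l. apply Rabs_le. nra. }
    assert (Hinv : / t < eps / 2).
    { replace (eps / 2) with (/ (2 / eps)) by (field; lra). apply Rinv_lt_contravar.
      - apply Rmult_lt_0_compat; [apply Rdiv_lt_0_compat|]; lra.
      - apply Rlt_le_trans with (1 := HN2). unfold t. apply le_INR. lia. }
    unfold pi_emp. fold t x.
    replace (x / t - / D) with ((x / t - Zh omega n j / T omega n) + (Zh omega n j / T omega n - / D)) by ring.
    eapply Rle_lt_trans; [apply Rabs_triang|]. lra. }
  intros v Hv. destruct v as [j|i m]; simpl.
  - apply Hint. now apply Nat.ltb_lt.
  - unfold valid, validb in Hv. apply andb_prop in Hv. rewrite !Nat.ltb_lt in Hv. destruct Hv as [Hi Hm].
    assert (HD : 3 <= D) by exact (D_ge_3 d Hd).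
    intros eps Heps.
    assert (HN : forall p, (p <= d)%nat -> exists N, forall j, (j < p)%nat -> forall n, (n >= N)%nat ->
       Rdist (pi_emp d r z0 omega n (Int j)) (/ D) < eps / D).
    { induction p as [|p IHp]; intros Hp; [exists 0%nat; intros; lia|].
      destruct IHp as (N & HN); [lia|].
      destruct (Hint p ltac:(lia) (eps / D)) as (N' & HN'); [apply Rdiv_lt_0_compat; lra|].
      exists (N + N')%nat. intros j Hj n Hn. destruct (Nat.eq_dec j p) as [->|]; [apply HN'|apply HN]; lia. }
    destruct (HN d (le_n _)) as (N & HNd). exists N. intros n Hn. unfold Rdist.
    rewrite Rminus_0_r. pose proof (Ht n) as Htn. set (t := INR (t0 d r z0 + n)) in *.
    assert (Hp0 : 0 <= pi_emp d r z0 omega n (Leaf i m)).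
    { apply Rmult_le_pos; [apply pos_INR|]. left; apply Rinv_0_lt_compat. fold t; lra. }
    rewrite Rabs_pos_eq by auto.
    assert (HLf : Zw z0 omega n (Leaf i m) <= t - sumN d (fun j => Zw z0 omega n (Int j))).
    { pose proof (Htot n) as E. fold t in E.
      pose proof (sumN_term_le d i (Lh omega n) Hi (fun j _ => HLnn n j)).
      pose proof (sumN_term_le (r i) m (fun m => Zw z0 omega n (Leaf i m)) Hm (fun j _ => pos_INR _)) as H1.
      cbv beta in H1. change (sumN (r i) (fun m => Zw z0 omega n (Leaf i m))) with (Lh omega n i) in H1. lra. }
    assert (Hsum : 1 - sumN d (fun j => pi_emp d r z0 omega n (Int j)) < eps).
    { apply Rle_lt_trans with (sumN d (fun j => / D + (-1) * pi_emp d r z0 omega n (Int j))).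
      - rewrite sumN_plus, sumN_scal, sumN_const. fold D. right. field. lra.
      - assert (Hd1 : (0 < d)%nat) by lia.
        assert (Hterm : forall j, (j < d)%nat -> 0 < eps / D - (/ D + (-1) * pi_emp d r z0 omega n (Int j))).
        { intros j Hj. specialize (HNd j Hj n Hn). unfold Rdist in HNd. apply Rabs_def2 in HNd. lra. }
        pose proof (sumN_term_le d 0 (fun j => eps / D + (-1) * (/ D + (-1) * pi_emp d r z0 omega n (Int j))) Hd1) as H0.
        cbv beta in H0. rewrite sumN_plus, sumN_scal, sumN_const in H0. fold D in H0.
        assert (Hlt := Hterm 0%nat Hd1).
        replace (D * (eps / D)) with eps in H0 by (field; lra).
        assert (H1 : forall j, (j < d)%nat -> 0 <= eps / D + (-1) * (/ D + (-1) * pi_emp d r z0 omega n (Int j))).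
        { intros j Hj. pose proof (Hterm j Hj). lra. }
        specialize (H0 H1). lra. }
    apply Rle_lt_trans with (2 := Hsum).
    assert (E : sumN d (fun j => pi_emp d r z0 omega n (Int j)) = / t * sumN d (fun j => Zw z0 omega n (Int j))).
    { rewrite <- sumN_scal. apply sumN_ext. intros j _. unfold pi_emp. fold t. unfold Rdiv. ring. }
    rewrite E. unfold pi_emp. fold t. apply (Rmult_le_reg_r t); [lra|].
    unfold Rdiv. rewrite Rmult_assoc, Rinv_l by lra.
    replace ((1 - / t * sumN d (fun j => Zw z0 omega n (Int j))) * t) with
      (t - sumN d (fun j => Zw z0 omega n (Int j))) by (field; lra). lra.
Qed.

Lemma vrrw_as_unif : vrrw_as d r z0 x0 (pi_inf_is_unif d r z0).
Proof.
  assert (Htr : forall omega n, 0 < cylP d r z0 x0 omega n -> sumL (verts d r) (trans d r z0 omega n) <= 1).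
  { intros omega n Hc. right. now apply trans_total. }
  apply as_impl with (fun omega => (forall n, 0 < cyl omega n) /\
    (exists q, Un_cv (value omega) q) /\
    (exists q, Un_cv (fun n => value omega n + total_gain omega n) q)).
  - intros omega (Hc & Hv & Hg). apply share_cv_unif; auto. now apply eff_share_cv.
  - apply as_and; [apply as_cylP_pos|]. apply as_and.
    + apply supermartingale_cv; auto. exact value_supermartingale.
    + apply (supermartingale_cv d r z0 x0 (fun omega n => value omega n + total_gain omega n)); auto.
      exact value_gain_supermartingale.
Qed.

End Reinforced.

Theorem theorem1 (d : nat) (r : nat -> nat) (z0 : vtx -> nat) (x0 : vtx) :
  (3 <= d)%nat ->
  (forall v, valid d r v -> (1 <= z0 v)%nat) ->
  valid d r x0 ->
  vrrw_as d r z0 x0 (pi_inf_is_unif d r z0).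
Proof. apply vrrw_as_unif. Qed.
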